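(* Assume that $R=\bigoplus_{\mathbf n\in\mathbb N_0^r}R_{\mathbf n}$ is positively graded and standard, and let $M$ be a $\mathbb Z^r$-graded $R$-module. Let $i\in\mathbb N_0$ and let $\mathfrak p\in{}^*\operatorname{Var}(R_{\mathbf 1}R)$. Then $$\operatorname{anch}^i(\mathfrak p,M)=\operatorname{anch}^i(\mathfrak p^{\phi(\mathfrak p)},M^{\phi(\mathfrak p)}),$$ and so $\operatorname{anch}^i(\mathfrak p,M)$ is finite if $M$ is finitely generated.
   Context: $r$ is a positive integer; $\mathbb N_0$ is the set of non-negative integers. $R$ is a commutative Noetherian ring graded by $\mathbb Z^r$. On $\mathbb Z^r$, $\mathbf n\le\mathbf m$ means $n_i\le m_i$ for all $i$; $\mathbf e_i$ is the $i$th unit vector, $\mathbf 1=(1,\dots,1)$. $R$ is positively graded if $R_{\mathbf n}=0$ for all $\mathbf n\not\ge\mathbf 0$; it is then standard if $R=R_{\mathbf 0}[R_{\mathbf e_1},\dots,R_{\mathbf e_r}]$. ${}^*\operatorname{Hom}_R(M,N)$ is the direct sum over $\mathbf a\in\mathbb Z^r$ of the groups of homogeneous homomorphisms $M\to N$ of degree $\mathbf a$, and ${}^*\operatorname{Ext}^i_R$ is its $i$th right derived functor in the category of $\mathbb Z^r$-graded $R$-modules and degree-$\mathbf 0$ homogeneous homomorphisms. ${}^*\operatorname{Spec}(R)$ is the set of $\mathbb Z^r$-graded primes of $R$; ${}^*\operatorname{Var}(\mathfrak a)=\{\mathfrak p\in{}^*\operatorname{Spec}(R):\mathfrak p\supseteq\mathfrak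 a\}$. The homogeneous localizations $R_{(\mathfrak p)},M_{(\mathfrak p)}$ are obtained by inverting all homogeneous elements of $R\setminus\mathfrak p$. For a group homomorphism $\phi:\mathbb Z^r\to\mathbb Z^m$ and a $\mathbb Z^r$-graded module, ring or ideal $M$, $M^\phi$ denotes $M$ with the $\mathbb Z^m$-grading $(M^\phi)_{\mathbf h}=\bigoplus_{\phi(\mathbf n)=\mathbf h}M_{\mathbf n}$. For $\mathfrak p\in{}^*\operatorname{Spec}(R)$, $\operatorname{dir}(\mathfrak p)=\{j:R_{\mathbf e_j}\subseteq\mathfrak p\}$; this is non-empty if and only if $\mathfrak p\supseteq R_{\mathbf 1}$. If $\operatorname{dir}(\mathfrak p)=\{i_1<\dots<i_m\}\ne\emptyset$, then $\phi(\mathfrak p):\mathbb Z^r\to\mathbb Z^m$ is $\phi(\mathfrak p)(n_1,\dots,n_r)=(n_{i_1},\dots,n_{i_m})$. For $\mathfrak p\in{}^*\operatorname{Var}(R_{\mathbf 1}R)$ with $m=\#\operatorname{dir}(\mathfrak p)$, an $i$th level anchor point of $\mathfrak p$ for $M$ is an $\mathbf a\in\mathbb Z^m$ with $\big(\big({}^*\operatorname{Ext}^i_{R_{(\mathfrak p)}}(R_{(\mathfrak p)}/\mathfrak pR_{(\mathfrak p)},M_{(\mathfrak p)})\big)^{\phi(\mathfrak p)}\big)_{\mathbf a}\ne0$; $\operatorname{anch}^i(\mathfrak p,M)$ is the set of all of these. On the right-hand side of the displayed equation, $\mathfrak p^{\phi(\mathfrak p)}$ is regarded as a $\mathbb Z^m$-graded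 prime ideal of the $\mathbb Z^m$-graded, positively graded and standard ring $R^{\phi(\mathfrak p)}$; its set of directions is $\{1,\dots,m\}$, and $\operatorname{anch}^i$ is computed by the same definition over $R^{\phi(\mathfrak p)}$ with its $\mathbb Z^m$-grading, giving a subset of $\mathbb Z^m$. *)

(* Defs.v *)
From HB Require Import structures.
From mathcomp Require Import all_boot all_order all_algebra.
From mathcomp Require Import ring.
From mathcomp Require Import all_classical.

Set Implicit Arguments.
Unset Strict Implicit.
Unset Printing Implicit Defensive.

Import Order.TTheory GRing.Theory Num.Theory.
Local Open Scope classical_set_scope.
Local Open Scope ring_scope.

(* A grading on V by a group G is a family gr : G -> set V of subgroups of which
   V is the internal direct sum (is_grading); rgr A n and mgr M n are the
   degree-n parts of a graded ring A and of a graded module M. *)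

Section FiniteSums.
Variable V : zmodType.

(* Finite sums of elements of Q. *)
Definition sums (Q : set V) : set V :=
  [set x | exists2 s : seq V, (forall y, y \in s -> Q y) & x = \sum_(y <- s) y].

Lemma sums0 Q : sums Q 0.
Proof. by exists [::] => //; rewrite big_nil. Qed.

Lemma sums1 (Q : set V) x : Q x -> sums Q x.
Proof.
move=> Qx; exists [:: x]; last by rewrite big_seq1.
by move=> y; rewrite inE => /eqP ->.
Qed.

Lemma sumsD Q x y : sums Q x -> sums Q y -> sums Q (x + y).
Proof.
move=> [s Qs ->] [t Qt ->]; exists (s ++ t); last by rewrite big_cat.
by move=> z; rewrite mem_cat => /orP[/Qs|/Qt].
Qed.

Lemma sums_big (Q : set V) (I : eqType) (s : seq I) (P : pred I) (f : I -> V) :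
  (forall i, i \in s -> P i -> Q (f i)) -> sums Q (\sum_(i <- s | P i) f i).
Proof.
move=> H; rewrite big_seq_cond; elim/big_ind: _ => [||i /andP[]].
- exact: sums0.
- exact: sumsD.
- by move=> si Pi; apply: sums1; apply: H.
Qed.

Lemma sumsW (Q Q' : set V) x :
  (forall y, Q y -> sums Q' y) -> sums Q x -> sums Q' x.
Proof.
move=> H [s Qs ->]; rewrite big_seq; elim/big_ind: _ => [||y /Qs /H //].
- exact: sums0.
- exact: sumsD.
Qed.

End FiniteSums.

Lemma sums_map (V W : zmodType) (f : V -> W) (Q : set V) (Q' : set W) x :
  f 0 = 0 -> {morph f : x y / x + y} -> (forall y, Q y -> Q' (f y)) ->
  sums Q x -> sums Q' (f x).
Proof.
move=> f0 fD H [s Qs ->]; rewrite (big_morph f fD f0).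
by apply: sums_big => i si _; apply/H/Qs.
Qed.

Definition lspan (R : pzRingType) (V : lmodType R) (X : set V) : set V :=
  sums [set y | exists (a : R) (v : V), X v /\ y = a *: v].

Section Families.
Variables (G V : zmodType).
Implicit Types gr : G -> set V.

Definition homog gr : set V := [set x | exists n, gr n x].

(* The members of the family are subgroups whose sum is direct. *)
Record is_indep gr : Prop := IsIndep {
  gr0 : forall n, gr n 0;
  grB : forall n x y, gr n x -> gr n y -> gr n (x - y);
  gr_indep : forall (s : seq G) (f : G -> V), uniq s ->
    (forall n, gr n (f n)) -> \sum_(n <- s) f n = 0 ->
    forall n, n \in s -> f n = 0 }.

Record is_grading gr : Prop := IsGrading {
  grading_indep :> is_indep gr;
  grading_span : forall x, sums (homog gr) x }.

Lemma grN gr n x : is_indep gr -> gr n x -> gr n (- x).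
Proof. by move=> H Hx; rewrite -sub0r; apply: grB => //; apply: gr0. Qed.

Lemma grD gr n x y : is_indep gr -> gr n x -> gr n y -> gr n (x + y).
Proof. by move=> H Hx Hy; rewrite -[y]opprK; apply: grB => //; apply: grN. Qed.

Lemma gr_sum gr n (I : eqType) (s : seq I) (P : pred I) (f : I -> V) :
  is_indep gr -> (forall i, i \in s -> P i -> gr n (f i)) ->
  gr n (\sum_(i <- s | P i) f i).
Proof.
move=> H Hf; rewrite big_seq_cond; elim/big_ind: _ => [||i /andP[]//].
- exact: gr0.
- by move=> x y; apply: grD.
- exact: Hf.
Qed.

Lemma sums_decomp gr (P : set G) x : is_indep gr ->
  sums [set y | exists2 n, P n & gr n y] x ->
  exists (s : seq G) (f : G -> V), [/\ uniq s, (forall n, n \in s -> P n),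
    (forall n, gr n (f n)) & x = \sum_(n <- s) f n].
Proof.
move=> Hgr [s]; elim: s x => [|y s IH] x Hs ->.
  exists [::], (fun=> 0); split => //; first by move=> n; apply: gr0.
  by rewrite !big_nil.
have [|t [f [ut Pt Hf E]]] := IH (\sum_(z <- s) z) _ erefl.
  by move=> z zs; apply: Hs; rewrite inE zs orbT.
rewrite big_cons E.
have [n Pn gy] := Hs y (mem_head _ _).
pose g m := (if m \in t then f m else 0) + (if m == n then y else 0).
have Hg m : gr m (g m).
  apply: grD => //; first by case: ifP => _ //; apply: gr0.
  by case: eqP => [->|_] //; apply: gr0.
have eqg : n \notin t -> \sum_(m <- t) f m = \sum_(m <- t) g m.
  move=> nt; apply: eq_big_seq => m mt; rewrite /g mt.
  by case: eqP mt nt => [-> ->|_ _ _] //; rewrite addr0.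
have [nt|nt] := boolP (n \in t).
  exists t, g; split => //; rewrite big_split /= addrC.
  congr (_ + _); last by apply: eq_big_seq => m ->.
  by rewrite -big_mkcond /= -big_filter filter_pred1_uniq // big_seq1.
exists (n :: t), g; split => //=; first by rewrite nt.
  by move=> m; rewrite inE => /orP[/eqP -> //|/Pt].
by rewrite big_cons -eqg // /g (negPf nt) eqxx add0r.
Qed.

Lemma gr_indep_in gr (s : seq G) (f : G -> V) : is_indep gr -> uniq s ->
  (forall n, n \in s -> gr n (f n)) -> \sum_(n <- s) f n = 0 ->
  forall n, n \in s -> f n = 0.
Proof.
move=> Hgr us Hf E n ns; pose g m := if m \in s then f m else 0.
have <- : g n = f n by rewrite /g ns.
apply: (gr_indep Hgr us) => // [m|].
  by rewrite /g; case: ifP => [/Hf //|_]; apply: gr0.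
by rewrite -[RHS]E; apply: eq_big_seq => m ms; rewrite /g ms.
Qed.

End Families.

Record gradedRing (G : zmodType) := GradedRing {
  gring_sort :> comPzRingType;
  rgr : G -> set gring_sort;
  rgrP : is_grading rgr;
  rgr1 : rgr 0 1;
  rgrM : forall m n a b, rgr m a -> rgr n b -> rgr (m + n) (a * b) }.
Arguments rgr {G} A n : rename.
Arguments rgrP {G} A : rename.

Record gradedMod (G : zmodType) (A : gradedRing G) := GradedMod {
  gmod_sort :> lmodType A;
  mgr : G -> set gmod_sort;
  mgrP : is_grading mgr;
  mgrZ : forall m n (a : A) x, rgr A m a -> mgr n x -> mgr (m + n) (a *: x) }.
Arguments mgr {G A} M n : rename.
Arguments mgrP {G A} M : rename.

Definition regular_mod (G : zmodType) (A : gradedRing G) : gradedMod A :=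
  @GradedMod G A (A^o : lmodType A) (rgr A) (rgrP A) (@rgrM G A).

(* gs_gr says that the submodule is the sum of its homogeneous parts.  The
   family gr need not span V: this is used for *Hom inside all functions. *)
Record gradedSub (G : zmodType) (A : gradedRing G) (V : lmodType A)
    (gr : G -> set V) := GradedSub {
  gs_set : set V;
  gs0 : gs_set 0;
  gsD : forall x y, gs_set x -> gs_set y -> gs_set (x + y);
  gsZ : forall (a : A) x, gs_set x -> gs_set (a *: x);
  gs_gr : forall x, gs_set x -> sums (homog gr `&` gs_set) x }.
Coercion gs_set : gradedSub >-> set.

Section GradedSubPred.
Variables (G : zmodType) (A : gradedRing G) (V : lmodType A).
Variables (gr : G -> set V) (U : gradedSub gr).

Definition gs_pred : {pred V} := fun x => `[< gs_set U x >].

Lemma gs_predP x : reflect (gs_set U x) (x \in gs_pred).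
Proof. exact: asboolP. Qed.

Lemma gs_pred_closed : submod_closed gs_pred.
Proof.
split; first by apply/gs_predP; exact: gs0.
move=> a x y /gs_predP Hx /gs_predP Hy; apply/gs_predP.
by apply: gsD => //; exact: gsZ.
Qed.

HB.instance Definition _ := GRing.isSubmodClosed.Build A V gs_pred
  gs_pred_closed.
End GradedSubPred.

Section SubQuotient.
Variables (G : zmodType) (A : gradedRing G) (V : lmodType A).
Variables (gr : G -> set V) (U : gradedSub gr).
Hypothesis Hgr : is_indep gr.
Hypothesis HgrZ : forall m n (a : A) x,
  rgr A m a -> gr n x -> gr (m + n) (a *: x).

Definition sub_type := {x : V | x \in gs_pred U}.
HB.instance Definition _ := SubChoice.on sub_type.
HB.instance Definition _ := [SubChoice_isSubLmodule of sub_type by <:].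

Definition sub_gr (n : G) : set sub_type := [set x | gr n (val x)].

Lemma sub_valB (x y : sub_type) : val (x - y) = val x - val y.
Proof. exact: raddfB. Qed.
Lemma sub_valD (x y : sub_type) : val (x + y) = val x + val y.
Proof. exact: raddfD. Qed.
Lemma sub_val0 : val (0 : sub_type) = 0.
Proof. exact: raddf0. Qed.
Lemma sub_valZ (a : A) (x : sub_type) : val (a *: x) = a *: val x.
Proof. exact: linearZ. Qed.
Lemma sub_val_sum (I : Type) (s : seq I) (P : pred I) (f : I -> sub_type) :
  val (\sum_(i <- s | P i) f i) = \sum_(i <- s | P i) val (f i).
Proof. exact: raddf_sum. Qed.

Lemma sub_grP : is_grading sub_gr.
Proof.
split; first split.
- by move=> n; have := gr0 Hgr n; rewrite -sub_val0.
- by move=> n x y Hx Hy; have := grB Hgr Hx Hy; rewrite -sub_valB.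
- move=> s f us Hf E n ns; apply: val_inj; rewrite sub_val0.
  have E' : \sum_(n <- s) val (f n) = 0 by rewrite -sub_val_sum E sub_val0.
  exact: (gr_indep Hgr us Hf E' ns).
- move=> x; have [s Hs E] := gs_gr (elimT (gs_predP _ _) (valP x)).
  have Us y : y \in s -> y \in gs_pred U.
    by move=> /Hs[_ Uy]; apply/gs_predP.
  exists (pmap insub s : seq sub_type).
    move=> y; rewrite mem_pmap_sub => /Hs[[n gy] _]; by exists n.
  apply: val_inj; rewrite E sub_val_sum.
  rewrite -(big_map val xpredT id) pmap_filter; last exact: insubK.
  rewrite big_filter big_seq [RHS]big_seq_cond.
  by apply: eq_bigl => y; case: (boolP (y \in s)) => //= /Us yU; rewrite insubT.
Qed.

Lemma sub_grZ m n (a : A) (x : sub_type) :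
  rgr A m a -> sub_gr n x -> sub_gr (m + n) (a *: x).
Proof. by move=> Ha Hx; have := HgrZ Ha Hx; rewrite -sub_valZ. Qed.

Definition sub_mod : gradedMod A := GradedMod sub_grP sub_grZ.

Hypothesis Hspan : forall x, sums (homog gr) x.

Definition quot_type := Quotient.quot (gs_pred U).
HB.instance Definition _ := GRing.Zmodule.on quot_type.
Definition quot_pi (x : V) : quot_type := (\pi_(Quotient.quot (gs_pred U)) x)%qT.
Definition quot_repr (x : quot_type) : V := repr (x : Quotient.quot (gs_pred U)).

Lemma quot_reprK x : quot_pi (quot_repr x) = x.
Proof. exact: reprK. Qed.
Lemma quot_pi0 : quot_pi 0 = 0.
Proof. by rewrite /quot_pi piE. Qed.
Lemma quot_piD : {morph quot_pi : x y / x + y}.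
Proof. by move=> x y; rewrite /quot_pi piE. Qed.
Lemma quot_piB : {morph quot_pi : x y / x - y}.
Proof. by move=> x y; apply: (addIr (quot_pi y)); rewrite -quot_piD !subrK. Qed.
Lemma quot_piE x y : quot_pi x = quot_pi y <-> gs_set U (x - y).
Proof.
split=> [/eqP|/gs_predP H]; first by rewrite -Quotient.idealrBE => /gs_predP.
by apply/eqP; rewrite -Quotient.idealrBE.
Qed.
Lemma quot_pi_eq0 x : quot_pi x = 0 <-> gs_set U x.
Proof. by rewrite -quot_pi0 quot_piE subr0. Qed.

Definition quot_scale (a : A) (x : quot_type) : quot_type :=
  quot_pi (a *: quot_repr x).

Lemma quot_scaleE a x : quot_scale a (quot_pi x) = quot_pi (a *: x).
Proof. by apply/quot_piE; rewrite -scalerBr; apply/gsZ/quot_piE/quot_reprK. Qed.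

Lemma quot_scaleA a b x :
  quot_scale a (quot_scale b x) = quot_scale (a * b) x.
Proof. by rewrite -[x]quot_reprK !quot_scaleE scalerA. Qed.
Lemma quot_scale1 : left_id 1 quot_scale.
Proof. by move=> x; rewrite -[x]quot_reprK quot_scaleE scale1r. Qed.
Lemma quot_scaleDr : right_distributive quot_scale +%R.
Proof.
move=> a x y; rewrite -[x]quot_reprK -[y]quot_reprK.
by rewrite -quot_piD !quot_scaleE -quot_piD scalerDr.
Qed.
Lemma quot_scaleDl x : {morph quot_scale^~ x : a b / a + b}.
Proof.
by move=> a b; rewrite -[x]quot_reprK !quot_scaleE -quot_piD scalerDl.
Qed.
HB.instance Definition _ := GRing.Zmodule_isLmodule.Build A quot_type
  quot_scaleA quot_scale1 quot_scaleDr quot_scaleDl.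

Definition quot_gr (n : G) : set quot_type := quot_pi @` gr n.

Lemma quot_grP : is_grading quot_gr.
Proof.
split; first split.
- by move=> n; exists 0; [exact: gr0|exact: quot_pi0].
- move=> n _ _ [x Hx <-] [y Hy <-]; exists (x - y); first exact: grB.
  exact: quot_piB.
- move=> s f us Hf E n ns.
  have [g Hg] : {g & forall n, gr n (g n) /\ quot_pi (g n) = f n}.
    by apply: (@choice _ _ (fun n x => gr n x /\ quot_pi x = f n)) => k;
      have [x ? ?] := Hf k; exists x.
  have : gs_set U (\sum_(n <- s) g n).
    apply/quot_pi_eq0; rewrite (big_morph quot_pi quot_piD quot_pi0).
    by rewrite -[RHS]E; apply: eq_bigr => k _; have [] := Hg k.
  move=> /gs_gr; set X := \sum_(n <- s) g n => HX.
  have Hi : is_indep (fun n => gr n `&` U).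
    split=> [k|k x y [? ?] [? ?]|r e ur He Er k kr].
    + by split; [exact: gr0|exact: gs0].
    + split; first exact: grB.
      by apply: gsD => //; rewrite -scaleN1r; exact: gsZ.
    + by apply: (gr_indep Hgr ur) kr => // k'; have [] := He k'.
  have HX' : sums [set y | exists2 k, setT k & (gr k `&` U) y] X.
    by apply: sumsW HX => x [[k gx] Ux]; apply: sums1; exists k.
  have [t [h [ut _ Hh Eh]]] := sums_decomp Hi HX'.
  pose e k := (if k \in s then g k else 0) - (if k \in t then h k else 0).
  have e0 k : k \in undup (s ++ t) -> e k = 0.
    apply: (gr_indep Hgr (undup_uniq _)) => [j|].
      apply: grB => //.
        by case: ifP => _; [have [] := Hg j|exact: gr0].
      by case: ifP => _; [have [] := Hh j|exact: gr0].
    have S (r : seq G) (w : G -> V) : uniq r -> {subset r <= undup (s ++ t)} ->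
        \sum_(k <- undup (s ++ t)) (if k \in r then w k else 0)
        = \sum_(k <- r) w k.
      move=> ur sr; rewrite -big_mkcond -big_filter; apply: perm_big.
      apply: uniq_perm => //; first exact/filter_uniq/undup_uniq.
      by move=> k'; rewrite mem_filter andb_idr // => /sr.
    rewrite sumrB !S // ?subrr; first by rewrite -/X Eh subrr.
    + by move=> k' kt; rewrite mem_undup mem_cat kt orbT.
    + by move=> k' ks; rewrite mem_undup mem_cat ks.
  have [_ <-] := Hg n; apply/quot_pi_eq0.
  have := e0 n; rewrite mem_undup mem_cat ns /e ns => /(_ erefl).
  move/eqP; rewrite subr_eq0 => /eqP ->.
  by case: ifP => _; [have [] := Hh n|exact: gs0].
- move=> x; rewrite -[x]quot_reprK.
  apply: (sums_map quot_pi0 quot_piD) (Hspan _) => y [n Hy].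
  by exists n, y.
Qed.

Lemma quot_grZ m n (a : A) (x : quot_type) :
  rgr A m a -> quot_gr n x -> quot_gr (m + n) (a *: x).
Proof.
move=> Ha [y Hy <-]; exists (a *: y); first exact: HgrZ.
by rewrite [RHS]quot_scaleE.
Qed.

Definition quot_mod : gradedMod A := GradedMod quot_grP quot_grZ.

End SubQuotient.

(* Graded prime ideals. *)
Record starSpec (G : zmodType) (A : gradedRing G) := StarSpec {
  sp_sub :> gradedSub (V := A^o) (rgr A);
  sp_proper : ~ gs_set sp_sub (1 : A);
  sp_prime : forall a b : A, gs_set sp_sub (a * b) ->
    gs_set sp_sub a \/ gs_set sp_sub b }.

Section HomogeneousDenominators.
Variables (G : zmodType) (A : gradedRing G) (p : starSpec A).

Definition hmult : set A := [set s | homog (rgr A) s /\ ~ gs_set p s].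

Definition denom := {s : A | `[< hmult s >]}.
HB.instance Definition _ := SubChoice.on denom.

Lemma denomP (s : denom) : hmult (val s).
Proof. exact/asboolP/(valP s). Qed.

Lemma hmult1 : hmult 1.
Proof. by split; [exists 0; exact: rgr1|exact: sp_proper]. Qed.

Lemma hmultM s t : hmult s -> hmult t -> hmult (s * t).
Proof.
move=> [[m sm] ps] [[n tn] pt]; split; first by exists (m + n); apply: rgrM.
by move=> /sp_prime[].
Qed.

Definition mk_denom s (hs : hmult s) : denom := exist _ s (asboolT hs).
Definition denom1 : denom := mk_denom hmult1.
Definition denomM (s t : denom) : denom := mk_denom (hmultM (denomP s) (denomP t)).

Lemma denomME s t : val (denomM s t) = val s * val t. Proof. by []. Qed.
Lemma denom1E : val denom1 = 1. Proof. by []. Qed.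

End HomogeneousDenominators.

Section HLoc.
Variables (G : zmodType) (A : gradedRing G) (p : starSpec A) (M : lmodType A).
Local Notation D := (denom p).

(* x/s = y/t iff u(tx - sy) = 0 for some homogeneous u outside p. *)
Definition hloc_rel (x y : M * D) : bool :=
  `[< exists2 t, hmult p t & t *: (val y.2 *: x.1) = t *: (val x.2 *: y.1) >].

Lemma hloc_rel_class : equiv_class_of hloc_rel.
Proof.
split=> [x|x y|y x z].
- by apply/asboolP; exists 1; first exact: hmult1.
- by apply/asboolP/asboolP => -[t ht E]; exists t.
- move=> /asboolP[t ht E] /asboolP[u hu F]; apply/asboolP.
  exists (t * u * val y.2); first exact: hmultM (hmultM ht hu) (denomP _).
  have -> : (t * u * val y.2) *: (val z.2 *: x.1)
          = (u * val z.2) *: (t *: (val y.2 *: x.1)).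
    by rewrite !scalerA; congr (_ *: _); ring.
  rewrite E.
  have -> : (u * val z.2) *: (t *: (val x.2 *: y.1))
          = (t * val x.2) *: (u *: (val z.2 *: y.1)).
    by rewrite !scalerA; congr (_ *: _); ring.
  by rewrite F !scalerA; congr (_ *: _); ring.
Qed.
Canonical hloc_equiv := EquivRelPack hloc_rel_class.
Canonical hloc_encModRel := defaultEncModRel hloc_rel.

Definition hloc := {eq_quot hloc_rel}%qT.
HB.instance Definition _ := Choice.on hloc.

Definition frac (x : M) (s : D) : hloc := (\pi_({eq_quot hloc_rel}%qT) (x, s))%qT.

Lemma fracE x s y t : frac x s = frac y t <->
  exists2 u, hmult p u & u *: (val t *: x) = u *: (val s *: y).
Proof.
rewrite /frac; split=> [/eqmodP/asboolP//|H]; exact/eqmodP/asboolP.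
Qed.

Lemma frac_surj z : exists x s, z = frac x s.
Proof.
by exists (repr (z : {eq_quot hloc_rel}%qT)).1, (repr (z : {eq_quot hloc_rel}%qT)).2;
  rewrite /frac -surjective_pairing reprK.
Qed.

Definition hnum (z : hloc) : M := (repr (z : {eq_quot hloc_rel}%qT)).1.
Definition hden (z : hloc) : D := (repr (z : {eq_quot hloc_rel}%qT)).2.
Lemma hfracK z : frac (hnum z) (hden z) = z.
Proof. by rewrite /frac -surjective_pairing reprK. Qed.

Lemma fracP x s : exists2 u, hmult p u &
  u *: (val s *: hnum (frac x s)) = u *: (val (hden (frac x s)) *: x).
Proof. by apply/fracE; rewrite hfracK. Qed.

Lemma frac_scale x s t : frac (val t *: x) (denomM s t) = frac x s.
Proof.
apply/fracE; exists 1; first exact: hmult1.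
by rewrite !scale1r scalerA.
Qed.

Definition hadd (z w : hloc) : hloc :=
  frac (val (hden w) *: hnum z + val (hden z) *: hnum w) (denomM (hden z) (hden w)).

Lemma haddE x s y t :
  hadd (frac x s) (frac y t) = frac (val t *: x + val s *: y) (denomM s t).
Proof.
apply/fracE; have [u hu E] := fracP x s; have [v hv F] := fracP y t.
set x' := hnum _ in E *; set s' := hden (frac x s) in E *.
set y' := hnum (frac y t) in F *; set t' := hden (frac y t) in F *.
exists (u * v); first exact: hmultM.
rewrite !denomME !scalerDr; congr (_ + _).
  transitivity ((v * val t * val t') *: (u *: (val s *: x'))).
    by rewrite !scalerA; congr (_ *: _); ring.
  by rewrite E !scalerA; congr (_ *: _); ring.
transitivity ((u * val s * val s') *: (v *: (val t *: y'))).
  by rewrite !scalerA; congr (_ *: _); ring.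
by rewrite F !scalerA; congr (_ *: _); ring.
Qed.

Lemma haddE1 x y s : hadd (frac x s) (frac y s) = frac (x + y) s.
Proof.
rewrite haddE; apply/fracE; exists 1; first exact: hmult1.
by rewrite !scale1r denomME -scalerDr scalerA.
Qed.

Definition hopp (z : hloc) : hloc := frac (- hnum z) (hden z).
Lemma hoppE x s : hopp (frac x s) = frac (- x) s.
Proof.
apply/fracE; have [u hu E] := fracP x s; exists u => //.
by rewrite !scalerN E.
Qed.

Lemma haddA : associative hadd.
Proof.
move=> z w v; rewrite -[z]hfracK -[w]hfracK -[v]hfracK.
move: (hnum z) (hden z) (hnum w) (hden w) (hnum v) (hden v) => x s y t w' u.
rewrite !haddE; apply/fracE; exists 1; first exact: hmult1.
rewrite !scale1r !denomME !scalerDr !scalerA addrA.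
by congr (_ *: _ + _ *: _ + _ *: _); ring.
Qed.

Lemma haddC : commutative hadd.
Proof.
move=> z w; rewrite -[z]hfracK -[w]hfracK !haddE addrC.
apply/fracE; exists 1; first exact: hmult1.
by rewrite !denomME [val (hden z) * _]mulrC.
Qed.

Definition hzero : hloc := frac 0 (denom1 p).

Lemma frac0 s : frac 0 s = hzero.
Proof. by apply/fracE; exists 1; rewrite ?scaler0 //; exact: hmult1. Qed.

Lemma hadd0 : left_id hzero hadd.
Proof.
by move=> z; rewrite -[z]hfracK -(frac0 (hden z)) haddE1 add0r.
Qed.

Lemma haddN : left_inverse hzero hopp hadd.
Proof. by move=> z; rewrite -[z]hfracK hoppE haddE1 addNr frac0. Qed.

HB.instance Definition _ := GRing.isZmodule.Build hloc haddA haddC hadd0 haddN.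

Lemma fracD x s y t :
  frac x s + frac y t = frac (val t *: x + val s *: y) (denomM s t).
Proof. exact: haddE. Qed.
Lemma fracD1 x y s : frac x s + frac y s = frac (x + y) s.
Proof. exact: haddE1. Qed.
Lemma fracN x s : - frac x s = frac (- x) s.
Proof. exact: hoppE. Qed.
Lemma fracB1 x y s : frac x s - frac y s = frac (x - y) s.
Proof. by rewrite fracN fracD1. Qed.
Lemma frac_0 s : frac 0 s = 0.
Proof. exact: frac0. Qed.
Lemma frac_eq0 x s : frac x s = 0 <-> exists2 u, hmult p u & u *: x = 0.
Proof.
rewrite -(frac_0 (denom1 p)) fracE; split=> -[u hu].
  by rewrite denom1E scale1r !scaler0; exists u.
by move=> E; exists u => //; rewrite denom1E scale1r !scaler0.
Qed.
Lemma frac_sum (I : Type) (r : seq I) (P : pred I) (f : I -> M) s :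
  \sum_(i <- r | P i) frac (f i) s = frac (\sum_(i <- r | P i) f i) s.
Proof.
by rewrite (big_morph (frac^~ s) (fun x y => esym (fracD1 x y s)) (frac_0 s)).
Qed.

End HLoc.

Section HLocScale.
Variables (G : zmodType) (A : gradedRing G) (p : starSpec A).

Definition hscale (M : lmodType A) (a : hloc p (A^o : lmodType A))
    (z : hloc p M) : hloc p M :=
  frac ((hnum a : A) *: hnum z) (denomM (hden a) (hden z)).

Lemma hscaleE (M : lmodType A) (a : A) s (x : M) t :
  hscale (@frac _ _ p (A^o : lmodType A) a s) (frac x t)
  = frac (a *: x) (denomM s t).
Proof.
apply/fracE; have [u hu] := @fracP _ _ p (A^o : lmodType A) a s.
have [v hv F] := fracP x t.
set a' := hnum _; set s' := hden (@frac _ _ p (A^o : lmodType A) a s).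
set x' := hnum (frac x t) in F *; set t' := hden (frac x t) in F *.
move=> E; have {}E : u * (val s * a') = u * (val s' * a) := E.
exists (u * v); first exact: hmultM.
transitivity ((u * (val s * a')) *: (v *: (val t *: x'))).
  by rewrite !denomME !scalerA; congr (_ *: _); ring.
by rewrite E F !denomME !scalerA; congr (_ *: _); ring.
Qed.

Lemma hscaleA (M : lmodType A) (a b : hloc p (A^o : lmodType A)) (z : hloc p M) :
  hscale a (hscale b z) = hscale (hscale a b) z.
Proof.
rewrite -[a]hfracK -[b]hfracK -[z]hfracK.
move: (hnum a : A) (hden a) (hnum b : A) (hden b) => {}a s {}b t.
rewrite !hscaleE; apply/fracE.
exists 1; first exact: hmult1.
rewrite !denomME !scalerA -[a *: (b : A^o)]/(a * b); congr (_ *: _); ring.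
Qed.

Lemma hscaleDr (M : lmodType A) (a : hloc p (A^o : lmodType A)) :
  {morph @hscale M a : x y / x + y}.
Proof.
move=> z w; rewrite -[a]hfracK -[z]hfracK -[w]hfracK fracD !hscaleE fracD.
apply/fracE; exists 1; first exact: hmult1.
rewrite !denomME !scalerDr !scalerA; congr (_ *: _ + _ *: _); ring.
Qed.

Lemma hscaleDl (M : lmodType A) (z : hloc p M) :
  {morph (fun a => hscale a z) : a b / a + b}.
Proof.
move=> a b; rewrite -[a]hfracK -[z]hfracK -[b]hfracK.
move: (hnum a : A) (hden a) (hnum b : A) (hden b) => {}a s {}b t.
rewrite fracD !hscaleE fracD; apply/fracE; exists 1; first exact: hmult1.
rewrite !denomME !scalerDr !scalerA -scalerDl; congr (_ *: _).
rewrite -[val t *: (a : A^o)]/(val t * a) -[val s *: (b : A^o)]/(val s * b); ring.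
Qed.

Definition hone : hloc p (A^o : lmodType A) := frac (1 : A^o) (denom1 p).

Lemma hscale1 (M : lmodType A) : left_id hone (@hscale M).
Proof.
move=> z; rewrite -[z]hfracK hscaleE scale1r; apply/fracE.
by exists 1; [exact: hmult1|rewrite denomME denom1E mul1r].
Qed.

Definition hloc_ring := hloc p (A^o : lmodType A).
HB.instance Definition _ := GRing.Zmodule.on hloc_ring.

Lemma hmulC : commutative (@hscale (A^o : lmodType A)).
Proof.
move=> a b; rewrite -[a]hfracK -[b]hfracK !hscaleE; apply/fracE.
exists 1; first exact: hmult1.
by rewrite !denomME /GRing.scale /=; ring.
Qed.

HB.instance Definition _ := GRing.Zmodule_isComPzRing.Build hloc_ring
  (@hscaleA (A^o : lmodType A)) hmulC (@hscale1 (A^o : lmodType A))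
  (fun a b c => @hscaleDl (A^o : lmodType A) c a b).

HB.instance Definition _ (M : lmodType A) :=
  GRing.Zmodule_isLmodule.Build hloc_ring (hloc p M)
  (@hscaleA M) (@hscale1 M) (@hscaleDr M) (@hscaleDl M).

End HLocScale.

Section HLocGrading.
Variables (G : zmodType) (A : gradedRing G) (p : starSpec A).

Section Module.
Variable M : gradedMod A.

(* x/s has degree n when x has degree n + deg s. *)
Definition hloc_gr (n : G) : set (hloc p M) :=
  [set z | exists (x : M) (s : denom p) (k : G),
     [/\ mgr M (n + k) x, rgr A k (val s) & z = frac x s]].

Lemma denom_deg (s : denom p) : exists k, rgr A k (val s).
Proof. by have [] := denomP s. Qed.

Lemma mgrZC m n (a : A) (x : M) :
  rgr A m a -> mgr M n x -> mgr M (n + m) (a *: x).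
Proof. by rewrite addrC; apply: mgrZ. Qed.

Lemma hloc_common (s : seq G) (f : G -> hloc p M) :
  (forall n, hloc_gr n (f n)) ->
  exists (t : denom p) (k : G) (g : G -> M), rgr A k (val t) /\
    forall n, n \in s -> mgr M (n + k) (g n) /\ f n = frac (g n) t.
Proof.
move=> Hf; elim: s => [|n s [t [k [g [tk Hg]]]]].
  by exists (denom1 p), 0, (fun=> 0); split; [exact: rgr1|].
have [x [u [l [Hx ul E]]]] := Hf n.
exists (denomM t u), (k + l),
  (fun m => if m == n then val t *: x else val u *: g m).
split; first exact: rgrM.
move=> m; rewrite inE; case: eqP => [-> _|_ /= ms].
  split; first by rewrite [k + l]addrC addrA; exact: mgrZC.
  rewrite E -(frac_scale x u t); apply/fracE; exists 1; first exact: hmult1.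
  by rewrite !denomME mulrC.
have [Hgm ->] := Hg m ms; rewrite frac_scale; split => //.
by rewrite addrA; exact: mgrZC.
Qed.

Lemma hloc_grP : is_grading hloc_gr.
Proof.
split; first split.
- move=> n; exists 0, (denom1 p), 0; split; [|exact: rgr1|by rewrite frac_0].
  exact: (gr0 (mgrP M)).
- move=> n _ _ [x [s [k [Hx sk ->]]]] [y [t [l [Hy tl ->]]]].
  exists (val t *: x + val s *: - y), (denomM s t), (k + l); split.
  + apply: (grD (mgrP M)); first by rewrite addrA; exact: mgrZC.
    rewrite [k + l]addrC addrA; apply: mgrZC => //.
    exact: (grN (mgrP M)).
  + exact: rgrM.
  + by rewrite fracN fracD.
- move=> s f us Hf E n ns.
  have [t [k [g [tk Hg]]]] := hloc_common s Hf.
  have : \sum_(n <- s) frac (g n) t = 0.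
    by rewrite -[RHS]E; apply: eq_big_seq => m /Hg[_ ->].
  rewrite frac_sum => /frac_eq0[u [[l ul] pu] Eu].
  have [_ ->] := Hg n ns; apply/frac_eq0; exists u; first by split => //; exists l.
  pose h m := u *: g (m - (k + l)).
  have <- : h (n + (k + l)) = u *: g n by rewrite /h addrK.
  have inj : injective (fun m : G => m + (k + l)) by move=> a b /addIr.
  apply: (gr_indep_in (mgrP M) (s := [seq m + (k + l) | m <- s])).
  + by rewrite map_inj_uniq.
  + move=> _ /mapP[m ms ->]; rewrite /h addrK addrA.
    by apply: mgrZC => //; have [] := Hg m ms.
  + rewrite big_map -[RHS]Eu scaler_sumr; apply: eq_bigr => m _.
    by rewrite /h addrK.
  + exact: map_f.
- move=> z; rewrite -[z]hfracK; have [k dk] := denom_deg (hden z).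
  apply: (@sums_map M (hloc p M) (fun x => frac x (hden z)) (homog (mgr M))
            (homog hloc_gr) (hnum z) (frac_0 _ _)) => [x y|y [n Hy]|].
  - by rewrite fracD1.
  - by exists (n - k), y, (hden z), k; rewrite subrK.
  - exact: (grading_span (mgrP M)).
Qed.

End Module.

Definition hloc_ring_gr : G -> set (hloc_ring p) := @hloc_gr (regular_mod A).

Lemma hloc_grZ (M : gradedMod A) m n (a : hloc_ring p) (z : hloc p M) :
  hloc_ring_gr m a -> hloc_gr n z -> hloc_gr (m + n) (a *: z).
Proof.
move=> [b [s [k [Hb sk ->]]]] [x [t [l [Hx tl ->]]]].
exists ((b : A) *: x), (denomM s t), (k + l); split.
- by rewrite addrACA; exact: mgrZ.
- exact: rgrM.
- exact: hscaleE.
Qed.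

Lemma hloc_ring_gr1 : hloc_ring_gr 0 1.
Proof.
exists (1 : A), (denom1 p), 0; split; [|exact: rgr1|by []].
by rewrite addr0; exact: rgr1.
Qed.

Definition hloc_gring : gradedRing G := @GradedRing G (hloc_ring p)
  hloc_ring_gr (hloc_grP (regular_mod A)) hloc_ring_gr1
  (@hloc_grZ (regular_mod A)).

Definition hloc_gmod (M : gradedMod A) : gradedMod hloc_gring :=
  @GradedMod G hloc_gring (hloc p M) (@hloc_gr M) (hloc_grP M) (@hloc_grZ M).

(* The extension pR_(p): the ideal generated by the image of p. *)
Definition hloc_max_set : set hloc_gring :=
  lspan (V := hloc_gring^o)
    [set z | exists2 x : A, gs_set p x & z = frac (x : A^o) (denom1 p)].

Lemma hloc_max_Z (a z : hloc_gring) : hloc_max_set z -> hloc_max_set (a * z).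
Proof.
apply: (sums_map (f := fun z => a * z)); rewrite ?mulr0 //.
  by move=> x y; rewrite mulrDr.
by move=> _ [b [v [pv ->]]]; exists (a * b), v; split=> //; exact: mulrA.
Qed.

Lemma hloc_max_gr (z : hloc_gring) :
  hloc_max_set z -> sums (homog (rgr hloc_gring) `&` hloc_max_set) z.
Proof.
apply: sumsW => _ [a [_ [[x px ->] ->]]].
set b := (frac _ _ : hloc_ring p).
rewrite -[a *: _]/(a * b).
suff H : sums [set y | exists n (w : A), [/\ rgr hloc_gring n y, y = frac (w : A^o) (denom1 p) & gs_set p w]] b.
  move: H => [s Hs ->]; rewrite mulr_sumr big_seq.
  elim/big_ind: _ => [||y ys]; [exact: sums0|exact: sumsD|].
  have [n [w [yn Ey pw]]] := Hs y ys.
  apply: (sums_map (f := fun c => c * y) (mul0r _) _ _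
           (grading_span (rgrP hloc_gring) a)) => [c d|c [m cm]].
    by rewrite mulrDl.
  split; first by exists (m + n); exact: rgrM.
  apply: sums1; exists c, y; split => //.
  by exists w.
apply: (@sums_map A (hloc_ring p) (fun y => frac (y : A^o) (denom1 p))
  (homog (rgr A) `&` gs_set p) _ x (frac_0 _ _)) => [y w|y [[n Hy] py]|].
- by rewrite -fracD1.
- exists n, y; split => //; exists y, (denom1 p), 0.
  by split => //; [rewrite addr0|exact: rgr1].
- exact: gs_gr px.
Qed.

Definition hloc_max : gradedSub (V := hloc_gring^o) (rgr hloc_gring) :=
  @GradedSub G hloc_gring hloc_gring^o (rgr hloc_gring) hloc_max_set
    (@sums0 _ _) (@sumsD _ _) hloc_max_Z hloc_max_gr.

(* R_(p)/pR_(p) *)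
Definition residue_mod : gradedMod hloc_gring :=
  quot_mod hloc_max (rgrP hloc_gring) (@rgrM _ hloc_gring)
    (grading_span (rgrP hloc_gring)).

End HLocGrading.

Section Coarsening.
Variables (G H : zmodType) (phi : {additive G -> H}).

(* The degree-h part for the H-grading is the sum of the degree-n parts with
   phi n = h. *)
Definition coarse (V : zmodType) (gr : G -> set V) (h : H) : set V :=
  sums [set y | exists2 n, phi n = h & gr n y].

Lemma coarseP (V : zmodType) (gr : G -> set V) :
  is_grading gr -> is_grading (coarse gr).
Proof.
move=> Hgr; split; first split.
- by move=> h; exact: sums0.
- move=> h x y Hx Hy; apply: sumsD => //.
  apply: (sums_map (f := -%R) (oppr0 _) _ _ Hy) => [a b|a [n nh Ha]].
    by rewrite opprD.
  by exists n => //; exact: (grN Hgr).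
- move=> t F ut HF E h ht.
  have D h' : exists sf : seq G * (G -> V), [/\ uniq sf.1,
      (forall n, n \in sf.1 -> phi n = h'),
      (forall n, gr n (sf.2 n)) & F h' = \sum_(n <- sf.1) sf.2 n].
    have [s [f [? ? ? ?]]] := sums_decomp (P := [set n | phi n = h']) Hgr (HF h').
    by exists (s, f).
  have [sf Hsf] := choice D.
  have key n : n \in [seq n | h <- t, n <- (sf h).1] -> (sf (phi n)).2 n = 0.
    apply: (gr_indep_in (f := fun n => (sf (phi n)).2 n) Hgr).
    + apply: allpairs_uniq_dep => //; first by move=> h' _; have [] := Hsf h'.
      move=> [h1 n1] [h2 n2] /allpairsPdep[a [b [_ bs [-> ->]]]].
      move=> /allpairsPdep[c [d [_ ds [-> ->]]]] /= E'; subst d.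
      have [_ P1 _ _] := Hsf a; have [_ P2 _ _] := Hsf c.
      move: (P1 _ bs) (P2 _ ds) => <- <-; reflexivity.
    + by move=> m _; have [] := Hsf (phi m).
    + rewrite big_allpairs_dep -[RHS]E; apply: eq_bigr => h' _.
      have [_ P1 _ ->] := Hsf h'; apply: eq_big_seq => m ms.
      by rewrite (P1 m ms).
  have [_ P1 _ ->] := Hsf h; rewrite big_seq; apply: big1 => n ns.
  rewrite -(P1 n ns) key //.
  by apply/allpairsPdep; exists h, n.
- move=> x; apply: sumsW (grading_span Hgr x) => y [n Hy].
  by apply: sums1; exists (phi n); apply: sums1; exists n.
Qed.

Lemma coarseM (U V W : zmodType) (gU : G -> set U) (gV : G -> set V)
    (gW : G -> set W) (op : U -> V -> W) :
  (forall u, {morph op u : x y / x + y}) -> (forall u, op u 0 = 0) ->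
  (forall v, {morph op^~ v : x y / x + y}) -> (forall v, op 0 v = 0) ->
  (forall m n u v, gU m u -> gV n v -> gW (m + n) (op u v)) ->
  forall h k u v, coarse gU h u -> coarse gV k v -> coarse gW (h + k) (op u v).
Proof.
move=> Dr Zr Dl Zl HM h k u v Hu [s Hs ->].
rewrite (big_morph (op u) (Dr u) (Zr u)) big_seq.
elim/big_ind: _ => [||y /Hs[n nk yn]]; [exact: sums0|exact: sumsD|].
apply: (sums_map (f := op^~ y) (Zl y) (Dl y) _ Hu) => x [m mh xm].
by exists (m + n); [rewrite raddfD mh nk|exact: HM].
Qed.

Lemma coarse_ring1 (A : gradedRing G) : coarse (rgr A) 0 1.
Proof. by apply: sums1; exists 0; rewrite ?raddf0 //; exact: rgr1. Qed.

Lemma coarse_ringM (A : gradedRing G) h k (a b : A) :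
  coarse (rgr A) h a -> coarse (rgr A) k b -> coarse (rgr A) (h + k) (a * b).
Proof.
apply: coarseM; [exact: mulrDr|exact: mulr0| |exact: mul0r|exact: rgrM].
by move=> v x y; exact: mulrDl.
Qed.

Definition coarsen_ring (A : gradedRing G) : gradedRing H :=
  @GradedRing H A (coarse (rgr A)) (coarseP (rgrP A)) (coarse_ring1 A)
    (@coarse_ringM A).

Lemma coarse_modZ (A : gradedRing G) (M : gradedMod A) h k (a : A) (x : M) :
  coarse (rgr A) h a -> coarse (mgr M) k x -> coarse (mgr M) (h + k) (a *: x).
Proof.
apply: coarseM; [exact: scalerDr|exact: scaler0| |exact: scale0r|exact: mgrZ].
by move=> v y z; exact: scalerDl.
Qed.

Definition coarsen_mod (A : gradedRing G) (M : gradedMod A) :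
    gradedMod (coarsen_ring A) :=
  @GradedMod H (coarsen_ring A) M (coarse (mgr M)) (coarseP (mgrP M))
    (@coarse_modZ A M).

Lemma coarsen_sub_gr (A : gradedRing G) (p : starSpec A) (x : A) :
  gs_set p x -> sums (homog (coarse (rgr A)) `&` gs_set p) x.
Proof.
move=> px; apply: sumsW (gs_gr px) => y [[n yn] py]; apply: sums1.
by split => //; exists (phi n); apply: sums1; exists n.
Qed.

Definition coarsen_prime (A : gradedRing G) (p : starSpec A) :
    starSpec (coarsen_ring A) :=
  @StarSpec H (coarsen_ring A)
    (@GradedSub H (coarsen_ring A) (coarsen_ring A)^o (rgr (coarsen_ring A))
      (gs_set p) (gs0 p) (@gsD _ _ _ _ p) (@gsZ _ _ _ _ p)
      (@coarsen_sub_gr A p))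
    (@sp_proper _ _ p) (@sp_prime _ _ p).

End Coarsening.

(* Homogeneous homomorphisms of degree 0. *)
Record gradedHom (G : zmodType) (A : gradedRing G) (M N : gradedMod A) :=
  GradedHom {
    ghom :> M -> N;
    ghom_linear : linear ghom;
    ghom_deg : forall n x, mgr M n x -> mgr N n (ghom x) }.

HB.instance Definition _ (G : zmodType) (A : gradedRing G)
    (M N : gradedMod A) (f : gradedHom M N) :=
  GRing.isLinear.Build A M N _ (ghom f) (ghom_linear f).

Section GradedHomTheory.
Variables (G : zmodType) (A : gradedRing G) (M N : gradedMod A).
Variable f : gradedHom M N.

Lemma ghom0 : f 0 = 0. Proof. exact: linear0. Qed.
Lemma ghomD x y : f (x + y) = f x + f y. Proof. exact: linearD. Qed.
Lemma ghomZ (a : A) x : f (a *: x) = a *: f x. Proof. exact: linearZ. Qed.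
Lemma ghom_sum (I : Type) (s : seq I) (P : pred I) (F : I -> M) :
  f (\sum_(i <- s | P i) F i) = \sum_(i <- s | P i) f (F i).
Proof. exact: linear_sum. Qed.

End GradedHomTheory.

Section Cohomology.
Variables (G : zmodType) (A : gradedRing G).

Section Kernel.
Variables (K L : gradedMod A) (g : gradedHom K L).

Definition gker_set : set K := [set x | g x = 0].

Lemma gker_gr (x : K) : gker_set x -> sums (homog (mgr K) `&` gker_set) x.
Proof.
move=> gx0.
have H : sums [set y | exists2 n, setT n & mgr K n y] x.
  apply: sumsW (grading_span (mgrP K) x) => y [n Hy].
  by apply: sums1; exists n.
have [s [f [us _ Hf E]]] := sums_decomp (mgrP K) H.
rewrite E; apply: sums_big => n ns _; split; first by exists n.
apply: (gr_indep (mgrP L) (f := g \o f) us) ns => [m|].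
  exact: ghom_deg.
by rewrite -[RHS]gx0 E ghom_sum.
Qed.

Lemma gkerD x y : gker_set x -> gker_set y -> gker_set (x + y).
Proof. by move=> Hx Hy; rewrite /gker_set /= ghomD Hx Hy addr0. Qed.
Lemma gkerZ (a : A) x : gker_set x -> gker_set (a *: x).
Proof. by move=> Hx; rewrite /gker_set /= ghomZ Hx scaler0. Qed.

Definition gker : gradedSub (mgr K) :=
  GradedSub (ghom0 g) gkerD gkerZ gker_gr.

Definition ker_mod : gradedMod A := sub_mod gker (mgrP K) (@mgrZ _ _ K).

End Kernel.

Section Homology.
Variables (J K L : gradedMod A) (f : gradedHom J K) (g : gradedHom K L).
Hypothesis gf0 : forall y, g (f y) = 0.

Definition bound_set : set (ker_mod g) := [set x | exists y, val x = f y].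

Lemma bound0 : bound_set 0.
Proof. by exists 0; rewrite ghom0; exact: sub_val0. Qed.

Lemma boundD x y : bound_set x -> bound_set y -> bound_set (x + y).
Proof.
move=> [u Eu] [v Ev]; exists (u + v); rewrite ghomD -Eu -Ev.
exact: sub_valD.
Qed.

Lemma boundZ (a : A) x : bound_set x -> bound_set (a *: x).
Proof.
move=> [u Eu]; exists (a *: u); rewrite ghomZ -Eu.
exact: sub_valZ.
Qed.

Lemma bound_gr x : bound_set x -> sums (homog (mgr (ker_mod g)) `&` bound_set) x.
Proof.
move=> [u Eu]; have [s Hs E] := grading_span (mgrP J) u.
have P y : f y \in gs_pred (gker g) by apply/gs_predP; exact: gf0.
pose F y : ker_mod g := exist _ (f y) (P y).
suff -> : x = \sum_(y <- s) F y.
  apply: sums_big => y /Hs[n Hy] _; split; last by exists y.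
  by exists n; exact: (ghom_deg f Hy).
apply: val_inj; rewrite Eu E ghom_sum.
by rewrite [RHS]sub_val_sum.
Qed.

Definition bound : gradedSub (mgr (ker_mod g)) :=
  GradedSub bound0 boundD boundZ bound_gr.

Definition homology : gradedMod A :=
  quot_mod bound (mgrP (ker_mod g)) (@mgrZ _ _ (ker_mod g))
    (grading_span (mgrP (ker_mod g))).

End Homology.

End Cohomology.

Section StarHom.
Variables (G : zmodType) (A : gradedRing G).

Section Def.
Variables M N : gradedMod A.

Definition homog_hom (a : G) : set (M -> N) :=
  [set f | linear f /\ forall n x, mgr M n x -> mgr N (n + a) (f x)].

Lemma homog_hom_linear a f : homog_hom a f -> linear f.
Proof. by case. Qed.

Lemma homog_homP : is_indep homog_hom.
Proof.
split.
- move=> a; split; first by move=> c x y /=; rewrite scaler0 addr0.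
  by move=> n x _; exact: (gr0 (mgrP N)).
- move=> a f g [lf Hf] [lg Hg]; split=> [c x y|n x Hx].
    rewrite -[LHS]/(f (c *: x + y) - g (c *: x + y)) lf lg.
    by rewrite -[(f - g) x]/(f x - g x) scalerBr opprD addrACA.
  exact: (grB (mgrP N) (Hf _ _ Hx) (Hg _ _ Hx)).
- move=> s f us Hf E a sa; apply/funext => x.
  have [lf _] := Hf a; pose F : {linear M -> N} :=
    HB.pack (f a) (GRing.isLinear.Build A M N _ (f a) lf).
  have [t Ht ->] := grading_span (mgrP M) x.
  rewrite -[f a]/(F : M -> N) linear_sum big_seq; apply: big1 => y /Ht[n Hy].
  pose h k := f (k - n) y.
  rewrite -[F y]/(f a y); have -> : f a y = h (a + n) by rewrite /h addrK.
  apply: (gr_indep_in (mgrP N) (s := [seq k + n | k <- s])).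
  + by rewrite map_inj_uniq // => k l /addIr.
  + move=> _ /mapP[k ks ->]; rewrite /h addrK addrC.
    by have [_] := Hf k; apply.
  + rewrite big_map; have := congr1 (fun w : M -> N => w y) E.
    rewrite fct_sumE /= => E'; rewrite -[RHS]E'.
    by apply: eq_bigr => k _; rewrite /h addrK.
  + exact: map_f.
Qed.

Lemma homog_homZ m n (c : A) (f : M -> N) :
  rgr A m c -> homog_hom n f -> homog_hom (m + n) (c *: f).
Proof.
move=> Hc [lf Hf]; split=> [a x y|k x Hx].
  rewrite -[LHS]/(c *: f (a *: x + y)) lf scalerDr !scalerA [c * a]mulrC.
  by rewrite -scalerA.
by rewrite addrCA; apply: mgrZ => //; exact: Hf.
Qed.

Lemma star_subZ (c : A) (f : M -> N) :
  sums (homog homog_hom) f -> sums (homog homog_hom) (c *: f).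
Proof.
move=> [s Hs ->]; rewrite scaler_sumr big_seq.
elim/big_ind: _ => [||g /Hs[n Hg]]; [exact: sums0|exact: sumsD|].
apply: (@sums_map A (M -> N) (fun c => c *: g) (homog (rgr A)) _ c
   (scale0r _)) => [a b|a [m Ha]|]; last exact: grading_span (rgrP A) c.
  by rewrite scalerDl.
by exists (m + n); exact: homog_homZ.
Qed.

Lemma star_sub_gr f : sums (homog homog_hom) f ->
  sums (homog homog_hom `&` sums (homog homog_hom)) f.
Proof. by apply: sumsW => g Hg; apply: sums1; split=> //; exact: sums1. Qed.

Definition star_sub : gradedSub homog_hom :=
  GradedSub (@sums0 _ _) (@sumsD _ _) star_subZ star_sub_gr.

(* The sum of the groups homog_hom a inside all functions M -> N; the sum is
   direct by homog_homP. *)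
Definition starHom : gradedMod A := sub_mod star_sub homog_homP homog_homZ.

Lemma starHomP (f : starHom) : sums (homog homog_hom) (val f).
Proof. exact: (elimT (gs_predP star_sub _) (valP f)). Qed.

End Def.

Section Pullback.
Variables (P Q N : gradedMod A) (d : gradedHom P Q).

Lemma homog_hom_comp a (f : Q -> N) :
  homog_hom a f -> homog_hom a (f \o d : P -> N).
Proof.
move=> [lf Hf]; split=> [c x y|n x Hx]; first by rewrite /= ghomD ghomZ lf.
by apply: Hf; exact: ghom_deg.
Qed.

Lemma star_pull_subproof (f : starHom Q N) :
  (val f \o d : P -> N) \in gs_pred (star_sub P N).
Proof.
apply/gs_predP; apply: (@sums_map (Q -> N) (P -> N) (fun f => f \o d)
   (homog (@homog_hom Q N))) => //; last exact: starHomP.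
by move=> g [n Hg]; exists n; exact: homog_hom_comp.
Qed.

Definition star_pull_fun (f : starHom Q N) : starHom P N :=
  exist _ (val f \o d : P -> N) (star_pull_subproof f).

Lemma star_pull_linear : linear star_pull_fun.
Proof. by move=> c f g; apply: val_inj. Qed.

Lemma star_pull_deg n f :
  mgr (starHom Q N) n f -> mgr (starHom P N) n (star_pull_fun f).
Proof. exact: homog_hom_comp. Qed.

Definition star_pull : gradedHom (starHom Q N) (starHom P N) :=
  GradedHom star_pull_linear star_pull_deg.

End Pullback.

Lemma star_pull0 (P Q S N : gradedMod A) (d : gradedHom P Q) (e : gradedHom Q S) :
  (forall x, e (d x) = 0) -> forall f, star_pull N d (star_pull N e f) = 0.
Proof.
move=> H f; apply: val_inj; apply/funext => x.
rewrite -[LHS]/(val f (e (d x))) H.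
have [s Hs ->] := starHomP f; rewrite fct_sumE big_seq.
apply: big1 => g /Hs[n [lg _]].
by have := lg (-1) 0 0; rewrite scaler0 addr0 scaleN1r addNr.
Qed.

End StarHom.

(* Projective objects of the category of graded A-modules and homogeneous
   homomorphisms of degree 0, whose epimorphisms are the surjections. *)
Definition projective (G : zmodType) (A : gradedRing G) (P : gradedMod A) :=
  forall (X Y : gradedMod A) (g : gradedHom X Y) (f : gradedHom P Y),
    (forall y, exists x, g x = y) ->
    exists h : gradedHom P X, forall z, g (h z) = f z.

Record projRes (G : zmodType) (A : gradedRing G) (C : gradedMod A) := ProjRes {
  pr_obj :> nat -> gradedMod A;
  pr_d : forall i, gradedHom (pr_obj i.+1) (pr_obj i);
  pr_aug : gradedHom (pr_obj 0%N) C;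
  pr_proj : forall i, projective (pr_obj i);
  pr_surj : forall y, exists x, pr_aug x = y;
  pr_exact0 : forall x, pr_aug x = 0 <-> exists y, pr_d 0 y = x;
  pr_exact : forall i x, pr_d i x = 0 <-> exists y, pr_d i.+1 y = x }.

Lemma ghom_lift (G : zmodType) (A : gradedRing G) (X Y : gradedMod A)
    (g : gradedHom X Y) : (forall y, exists x, g x = y) ->
  forall n y, mgr Y n y -> exists2 x, mgr X n x & g x = y.
Proof.
move=> sg n y Hy; have [x Ex] := sg y.
have H : sums [set y | exists2 n, setT n & mgr X n y] x.
  by apply: sumsW (grading_span (mgrP X) x) => z [m Hz]; apply: sums1; exists m.
have [s [f [us _ Hf E]]] := sums_decomp (mgrP X) H.
pose f' m := if m \in s then f m else 0.
have Hf' m : mgr X m (f' m).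
  by rewrite /f'; case: ifP => _ //; exact: (gr0 (mgrP X)).
exists (f' n) => //; apply/eqP; rewrite -subr_eq0; apply/eqP.
pose h m := g (f' m) - (if m == n then y else 0).
have <- : h n = g (f' n) - y by rewrite /h eqxx.
apply: (gr_indep (mgrP Y) (s := undup (n :: s)) (undup_uniq _)) => [m||].
- apply: (grB (mgrP Y)); first exact: ghom_deg.
  by case: eqP => [->|_] //; exact: (gr0 (mgrP Y)).
- rewrite sumrB -(big_mkcond (fun m => m == n)) -big_filter.
  rewrite filter_pred1_uniq ?undup_uniq ?mem_undup ?mem_head // big_seq1.
  rewrite -ghom_sum -Ex E; apply/eqP; rewrite subr_eq0; apply/eqP; congr (g _).
  rewrite /f' -big_mkcond -big_filter; apply: perm_big; apply: uniq_perm => //.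
    exact/filter_uniq/undup_uniq.
  move=> m; rewrite mem_filter mem_undup inE.
  by case: (m \in s); rewrite ?orbT.
- by rewrite mem_undup mem_head.
Qed.

Section FreeModule.
Variables (G : zmodType) (A : gradedRing G) (X : choiceType) (deg : X -> G).

Definition single (x : X) (a : A) : X -> A^o := fun y => if y == x then a else 0.

Definition free_gr (n : G) : set (X -> A^o) :=
  [set f | forall x, rgr A (n - deg x) (f x)].

Lemma singleD x : {morph single x : a b / a + b}.
Proof.
move=> a b; apply/funext => y; rewrite -[RHS]/(single x a y + single x b y).
by rewrite /single; case: ifP; rewrite ?addr0.
Qed.
Lemma single0 x : single x 0 = 0.
Proof. by apply/funext => y; rewrite /single; case: ifP. Qed.
Lemma singleZ x (a b : A) : a *: single x b = single x (a * b).
Proof.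
apply/funext => y; rewrite -[LHS]/(a * single x b y) /single.
by case: ifP; rewrite ?mulr0.
Qed.
Lemma single_gr x n a : rgr A n a -> free_gr (n + deg x) (single x a).
Proof.
move=> Ha y; rewrite /single; case: eqP => [->|_]; first by rewrite addrK.
exact: (gr0 (rgrP A)).
Qed.

Lemma free_grP : is_indep free_gr.
Proof.
split.
- by move=> n x; exact: (gr0 (rgrP A)).
- by move=> n f g Hf Hg x; exact: (grB (rgrP A) (Hf x) (Hg x)).
- move=> s f us Hf E n ns; apply/funext => x.
  pose h k := f (k + deg x) x : A.
  rewrite -[LHS]/(f n x); have -> : f n x = h (n - deg x) by rewrite /h subrK.
  apply: (gr_indep_in (rgrP A) (s := [seq k - deg x | k <- s])).
  + by rewrite map_inj_uniq // => k l /addIr.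
  + by move=> _ /mapP[k ks ->]; rewrite /h subrK; exact: Hf.
  + rewrite big_map; have := congr1 (fun w : X -> A^o => w x) E.
    rewrite fct_sumE /= => E'; rewrite -[RHS]E'.
    by apply: eq_bigr => k _; rewrite /h subrK.
  + exact: map_f.
Qed.

Lemma free_grZ m n (a : A) (f : X -> A^o) :
  rgr A m a -> free_gr n f -> free_gr (m + n) (a *: f).
Proof. by move=> Ha Hf x; rewrite -addrA; exact: rgrM. Qed.

Definition free_set : set (X -> A^o) :=
  sums [set f | exists x a, f = single x a].

Lemma free_setZ (c : A) f : free_set f -> free_set (c *: f).
Proof.
apply: sums_map; [exact: scaler0|exact: scalerDr|].
by move=> _ [x [a ->]]; exists x, (c * a); rewrite singleZ.
Qed.

Lemma free_set_gr f : free_set f -> sums (homog free_gr `&` free_set) f.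
Proof.
apply: sumsW => _ [x [a ->]].
apply: (@sums_map A (X -> A^o) (single x) (homog (rgr A)) _ a
  (single0 x) (@singleD x)) => [b [n Hb]|].
  split; first by exists (n + deg x); exact: single_gr.
  by apply: sums1; exists x, b.
exact: (grading_span (rgrP A)).
Qed.

Definition free_sub : gradedSub free_gr :=
  GradedSub (@sums0 _ _) (@sumsD _ _) free_setZ free_set_gr.

(* The free module with one generator of degree deg x for each x : X. *)
Definition free_mod : gradedMod A := sub_mod free_sub free_grP free_grZ.

Lemma free_supp (f : free_mod) :
  exists s : seq X, forall x, x \notin s -> val f x = 0.
Proof.
have [s Hs ->] := elimT (gs_predP free_sub _) (valP f).
elim: s Hs => [|g s IH] Hs; first by exists [::] => x _; rewrite big_nil.
have [|t Ht] := IH; first by move=> y ys; apply: Hs; rewrite inE ys orbT.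
have [x [a Eg]] := Hs g (mem_head _ _).
exists (x :: t) => y; rewrite inE negb_or => /andP[nyx yt].
rewrite big_cons -[LHS]/(g y + (\sum_(j <- s) j) y) Ht // addr0 Eg.
by rewrite /single (negPf nyx).
Qed.

Definition supp (f : free_mod) : seq X := undup (projT1 (cid (free_supp f))).

Lemma supp_out f x : x \notin supp f -> val f x = 0.
Proof. by rewrite /supp mem_undup; case: cid => t /= Ht; exact: Ht. Qed.

Section Eval.
Variables (M : gradedMod A) (w : X -> M).
Hypothesis Hw : forall x, mgr M (deg x) (w x).

Definition free_ev (f : free_mod) : M :=
  \sum_(x <- supp f) (val f x : A) *: w x.

Lemma free_evE (f : free_mod) (t : seq X) : uniq t ->
  (forall x, x \notin t -> val f x = 0) ->
  free_ev f = \sum_(x <- t) (val f x : A) *: w x.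
Proof.
have S (u v : seq X) : uniq u -> uniq v ->
    (forall x, x \notin u -> val f x = 0) ->
    (forall x, x \notin v -> val f x = 0) ->
    \sum_(x <- u) (val f x : A) *: w x = \sum_(x <- v) (val f x : A) *: w x.
  move=> uu uv Hu Hv.
  have R (z : seq X) : \sum_(x <- z) (val f x : A) *: w x
      = \sum_(x <- [seq x <- z | val f x != 0]) (val f x : A) *: w x.
    rewrite big_filter [RHS]big_mkcond; apply: eq_bigr => x _.
    by case: eqP => //= ->; exact: scale0r.
  rewrite R [RHS]R; apply: perm_big.
  apply: uniq_perm; rewrite ?filter_uniq // => x; rewrite !mem_filter.
  case: eqP => //= nz.
  have -> : x \in u by apply/negPn/negP => /Hu.
  by have -> : x \in v by apply/negPn/negP => /Hv.
by move=> ut Ht; apply: S => //; [exact: undup_uniq|exact: supp_out].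
Qed.

Lemma free_ev_linear : linear free_ev.
Proof.
move=> c f g; pose t := undup (supp f ++ supp g).
have Hf x : x \notin t -> val f x = 0.
  by rewrite mem_undup mem_cat negb_or => /andP[/supp_out].
have Hg x : x \notin t -> val g x = 0.
  by rewrite mem_undup mem_cat negb_or => /andP[_ /supp_out].
have Efg x : val (c *: f + g) x = c * val f x + val g x :> A.
  by rewrite sub_valD sub_valZ.
rewrite (free_evE (t := t)) ?undup_uniq //; last first.
  by move=> x xt; rewrite Efg Hf // Hg // mulr0 addr0.
rewrite (free_evE (undup_uniq _) Hf) (free_evE (undup_uniq _) Hg).
rewrite scaler_sumr -big_split; apply: eq_bigr => x _.
by rewrite Efg scalerDl scalerA.
Qed.

Lemma free_ev_deg n f : mgr free_mod n f -> mgr M n (free_ev f).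
Proof.
move=> Hf; apply: (gr_sum (mgrP M)) => x _ _.
by rewrite -[n](subrK (deg x)); apply: mgrZ => //; exact: Hf.
Qed.

Definition free_hom : gradedHom free_mod M :=
  GradedHom free_ev_linear free_ev_deg.

End Eval.

Lemma gen_subproof x : single x 1 \in gs_pred free_sub.
Proof. by apply/gs_predP; apply: sums1; exists x, 1. Qed.

Definition gen (x : X) : free_mod := exist _ (single x 1) (gen_subproof x).

Lemma gen_deg x : mgr free_mod (deg x) (gen x).
Proof. by have := single_gr x (rgr1 A); rewrite add0r. Qed.

Lemma free_gen (f : free_mod) :
  f = \sum_(x <- supp f) (val f x : A) *: gen x.
Proof.
apply: val_inj; rewrite sub_val_sum; apply/funext => y; rewrite fct_sumE.
have E x : val ((val f x : A) *: gen x) y = if x == y then val f x else 0.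
  rewrite -[LHS]/((val f x : A) * single x 1 y) /single eq_sym.
  by case: ifP => _; rewrite ?mulr1 ?mulr0.
under eq_bigr do rewrite E.
rewrite -big_mkcond -big_filter.
have [ys|ys] := boolP (y \in supp f).
  by rewrite filter_pred1_uniq ?undup_uniq // big_seq1.
rewrite (supp_out ys) big1_seq // => x /andP[_].
by rewrite mem_filter => /andP[/eqP -> /(negP ys)].
Qed.

Lemma free_hom_gen (M : gradedMod A) (w : X -> M)
    (Hw : forall x, mgr M (deg x) (w x)) x : free_hom Hw (gen x) = w x.
Proof.
rewrite -[LHS]/(free_ev w (gen x)) (free_evE w (t := [:: x])) //.
  rewrite big_seq1 -[val _ x]/(single x 1 x) /single eqxx; exact: scale1r.
by move=> y; rewrite inE -[val _ y]/(single x 1 y) /single => /negPf ->.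
Qed.

Lemma free_projective : projective free_mod.
Proof.
move=> U Y g f sg.
have [w Hw] : {w : X -> U & forall x, mgr U (deg x) (w x) /\ g (w x) = f (gen x)}.
  apply: (@choice _ _ (fun x u => mgr U (deg x) u /\ g u = f (gen x))) => x.
  by have [u Hu E] := ghom_lift sg (ghom_deg f (gen_deg x)); exists u.
have := free_hom_gen (fun x => proj1 (Hw x)).
move: (free_hom _) => h Hh; exists h => z.
rewrite [z]free_gen !ghom_sum; apply: eq_bigr => x _.
by rewrite !ghomZ Hh (proj2 (Hw x)).
Qed.

End FreeModule.

Section FreeResolution.
Variables (G : zmodType) (A : gradedRing G).

Section Cover.
Variable C : gradedMod A.

Definition homog_elt := {c : C | `[< homog (mgr C) c >]}.
HB.instance Definition _ := SubChoice.on homog_elt.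

Lemma homog_eltP (x : homog_elt) : exists n, mgr C n (val x).
Proof. exact: (elimT (asboolP _) (valP x)). Qed.

(* The zero element is homogeneous of every degree; it gets an arbitrary one. *)
Definition homog_deg (x : homog_elt) : G := projT1 (cid (homog_eltP x)).
Lemma homog_degP x : mgr C (homog_deg x) (val x).
Proof. by rewrite /homog_deg; case: cid => n /= Hn; exact: Hn. Qed.

Definition free_cover : gradedMod A := free_mod A homog_deg.
Definition cover : gradedHom free_cover C := free_hom homog_degP.

Lemma cover_surj y : exists x, cover x = y.
Proof.
have [s Hs ->] := grading_span (mgrP C) y.
elim: s Hs => [|c s IH] Hs; first by exists 0; rewrite big_nil ghom0.
have [|x Ex] := IH; first by move=> z zs; apply: Hs; rewrite inE zs orbT.
have Hc : `[< homog (mgr C) c >] by apply/asboolP/Hs/mem_head.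
exists (gen A homog_deg (exist _ c Hc : homog_elt) + x).
by rewrite big_cons ghomD Ex free_hom_gen.
Qed.

End Cover.

Section KernelInclusion.
Variables (K L : gradedMod A) (g : gradedHom K L).

Definition ker_incl : gradedHom (ker_mod g) K :=
  @GradedHom G A (ker_mod g) K val (fun _ _ _ => erefl) (fun _ _ H => H).

Lemma ker_inclP x : g x = 0 <-> exists y, ker_incl y = x.
Proof.
split=> [H|[y <-]]; last exact: (elimT (gs_predP (gker g) _) (valP y)).
by exists (exist _ x (introT (gs_predP (gker g) x) H)).
Qed.

End KernelInclusion.

Section Composition.
Variables (K L M : gradedMod A) (g : gradedHom L M) (f : gradedHom K L).

Lemma ghom_comp_linear : linear (g \o f).
Proof. by move=> c x y; rewrite /= !ghomD !ghomZ. Qed.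

Definition ghom_comp : gradedHom K M :=
  GradedHom ghom_comp_linear (fun n x H => ghom_deg g (ghom_deg f H)).

End Composition.

Variable C : gradedMod A.

Fixpoint syzygy (i : nat) : gradedMod A :=
  if i is j.+1 then ker_mod (cover (syzygy j)) else C.

Definition free_res_obj (i : nat) : gradedMod A := free_cover (syzygy i).

Definition free_res_d (i : nat) :
    gradedHom (free_res_obj i.+1) (free_res_obj i) :=
  ghom_comp (ker_incl (cover (syzygy i))) (cover (syzygy i.+1)).

Lemma free_res_exact0 i x :
  cover (syzygy i) x = 0 <-> exists y, free_res_d i y = x.
Proof.
split=> [/ker_inclP[z <-]|[y <-]]; last by apply/ker_inclP; eexists.
by have [y <-] := cover_surj z; exists y.
Qed.

Lemma free_res_exact i x :
  free_res_d i x = 0 <-> exists y, free_res_d i.+1 y = x.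
Proof.
rewrite -free_res_exact0; split=> [H|H].
  by apply: val_inj; rewrite sub_val0.
by rewrite -[LHS]/(ker_incl _ (cover (syzygy i.+1) x)) H ghom0.
Qed.

Definition free_res : projRes C :=
  @ProjRes G A C free_res_obj free_res_d (cover C)
    (fun i => @free_projective _ _ _ _) (@cover_surj C)
    (@free_res_exact0 0) free_res_exact.

End FreeResolution.

Section Ext.
Variables (G : zmodType) (A : gradedRing G).

Section Resolution.
Variables (C N : gradedMod A) (P : projRes C).

Lemma pr_dd i x : pr_d P i (pr_d P i.+1 x) = 0.
Proof. by apply/pr_exact; exists x. Qed.

(* The cohomology of the complex *Hom(P_0, N) -> *Hom(P_1, N) -> ..., where P
   is a graded projective resolution of C. *)
Definition res_cohomology (i : nat) : gradedMod A :=
  match i with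
  | 0 => ker_mod (star_pull N (pr_d P 0))
  | i.+1 => homology (star_pull0 (N := N) (@pr_dd i))
  end.

End Resolution.

(* The value at C of the i-th right derived functor of the contravariant functor
   *Hom(-, N) on graded A-modules, computed with the projective resolution of C
   by free modules on all homogeneous elements of the successive syzygies. *)
Definition starExt (i : nat) (C N : gradedMod A) : gradedMod A :=
  res_cohomology N (free_res C) i.

End Ext.

Definition starVar (G : zmodType) (A : gradedRing G) (I : set A) :
    set (starSpec A) := [set p : starSpec A | I `<=` gs_set p].

Definition noetherian (R : comPzRingType) : Prop :=
  forall I : set R, I 0 -> (forall x y, I x -> I y -> I (x + y)) ->
    (forall a x, I x -> I (a * x)) ->
    exists s : seq R, I = lspan (V := R^o) [set` s].

Definition fin_gen (R : pzRingType) (M : lmodType R) : Prop :=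
  exists s : seq M, lspan [set` s] = setT.

Section Multigraded.
Variable r : nat.
Implicit Type R : gradedRing 'rV[int]_r.

Definition positively_graded R : Prop :=
  forall n : 'rV[int]_r, ~ (forall j, 0 <= n 0 j) -> rgr R n = [set 0].

(* Every subring containing R_0 and all R_(e_j) is R. *)
Definition standard R : Prop :=
  forall B : {pred R}, subring_closed B ->
    (forall x, rgr R 0 x -> x \in B) ->
    (forall j x, rgr R (delta_mx 0 j) x -> x \in B) ->
    forall x, x \in B.

Definition dir R (p : starSpec R) : {set 'I_r} :=
  [set j | `[< rgr R (delta_mx 0 j) `<=` gs_set p >]]%SET.

(* enum_val lists the elements of dir p in increasing order. *)
Definition dir_proj R (p : starSpec R) :
    {additive 'rV[int]_r -> 'rV[int]_#|dir p|} :=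
  colsub (@enum_val _ (mem (dir p))).

Definition anch R (i : nat) (p : starSpec R) (M : gradedMod R) :
    set 'rV[int]_#|dir p| :=
  [set a | mgr (coarsen_mod (dir_proj p)
             (starExt i (residue_mod p) (hloc_gmod p M))) a <> [set 0]].

End Multigraded.

Arguments anch {r R} i p M.

(* Main.v *)
Require Import Defs.
From HB Require Import structures.
From mathcomp Require Import all_boot all_order all_algebra.
From mathcomp Require Import all_classical.

Set Implicit Arguments.
Unset Strict Implicit.
Unset Printing Implicit Defensive.

Import Order.TTheory GRing.Theory Num.Theory.
Local Open Scope classical_set_scope.
Local Open Scope ring_scope.

(* A homogeneous resolution of R/p by finitely generated graded free modules,
   which exists since R is noetherian, is given by matrices.  The same matrices
   resolve R_(p)/pR_(p) over R_(p), and, with degrees pushed forward along phi,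
   the residue module of p^phi over the homogeneous localization of R^phi.  By
   the comparison theorem for projective resolutions both *Ext modules are thus
   localizations of the cohomology H of one complex of finite powers of M: of H
   at the homogeneous elements outside p, respectively at the phi-homogeneous
   ones.  A homogeneous class of H that dies in the second localization already
   dies in the first one: if it is killed by a phi-homogeneous s outside p, then
   it is killed by each homogeneous component of s, and one of these lies
   outside p.  Hence *Ext^phi and the *Ext of the coarsened data are non-zero in
   the same degrees; this holds for every homomorphism phi.

   If M is finitely generated, so is H, and p kills H.  Every element of R is
   the sum of an element of p and of an element of phi(p)-degree 0 because R is
   standard, so the degrees of the anchor points are among the phi(p)-degrees of
   generators of the cocycles. *)

(* [frac] of MathComp's fraction.v shadows the one of Defs. *)
Local Notation frac := Defs.frac.

(** * Graded submodules and matrices acting on powers of a graded module *)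

Section GradedSubComponents.
Variables (G : zmodType) (A : gradedRing G) (M : gradedMod A).

Lemma gs_sum (U : gradedSub (mgr M)) (I : eqType) (s : seq I) (f : I -> M) :
  (forall i, i \in s -> gs_set U (f i)) -> gs_set U (\sum_(i <- s) f i).
Proof.
move=> H; rewrite big_seq; elim/big_ind: _ => //; first exact: gs0.
exact: gsD.
Qed.

(** The quotient by [U] is graded, so if the images of the components sum to zero there, each image
    is zero. *)
Lemma gs_component (U : gradedSub (mgr M)) (s : seq G) (f : G -> M) :
  uniq s -> (forall n, mgr M n (f n)) -> gs_set U (\sum_(n <- s) f n) ->
  forall n, n \in s -> gs_set U (f n).
Proof.
move=> us Hf HU n ns.
pose Q := quot_mod U (mgrP M) (@mgrZ _ _ M) (grading_span (mgrP M)).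
apply/quot_pi_eq0.
apply: (gr_indep (mgrP Q) (f := fun n => quot_pi U (f n)) us) ns => [k|].
  by exists (f k).
rewrite -(big_morph (quot_pi U) (@quot_piD _ _ _ _ U) (quot_pi0 U)).
exact/quot_pi_eq0.
Qed.

End GradedSubComponents.

Section MatrixAction.
Variables (A : comPzRingType) (N : lmodType A).

(** If the rows of [D] are the images of the basis vectors under a map from A^m to A^n, that map is
    [mxact D^T], and [mxact D] from N^n to N^m is what Hom(-, N) makes of it. *)
Definition mxact m n (D : 'M[A]_(m, n)) (z : 'I_n -> N) : 'I_m -> N :=
  fun j => \sum_k D j k *: z k.

Lemma mxactP m n (D : 'M[A]_(m, n)) : linear (mxact D).
Proof.
move=> c x y; apply/funext => j; rewrite /mxact.
rewrite -[RHS]/(c *: (\sum_k D j k *: x k) + \sum_k D j k *: y k).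
rewrite scaler_sumr -big_split; apply: eq_bigr => k _ /=.
rewrite -[(c *: x + y) k]/(c *: x k + y k) scalerDr !scalerA.
by rewrite [c * _]mulrC.
Qed.

HB.instance Definition _ m n (D : 'M[A]_(m, n)) :=
  GRing.isLinear.Build A ('I_n -> N) ('I_m -> N) _ (mxact D) (mxactP D).

Lemma mxact_mul m n q (D : 'M[A]_(m, n)) (E : 'M[A]_(n, q)) z :
  mxact (D *m E) z = mxact D (mxact E z).
Proof.
apply/funext => j; rewrite /mxact.
under eq_bigr do rewrite mxE scaler_suml.
rewrite exchange_big; apply: eq_bigr => k _ /=.
by rewrite scaler_sumr; apply: eq_bigr => l _; rewrite scalerA.
Qed.

Lemma mxactZ m n (D : 'M[A]_(m, n)) a z : mxact D (a *: z) = a *: mxact D z.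
Proof. exact: linearZZ. Qed.

Lemma mxactDl m n (D E : 'M[A]_(m, n)) z :
  mxact (D + E) z = mxact D z + mxact E z.
Proof.
apply/funext => j; rewrite -[RHS]/(mxact D z j + mxact E z j) /mxact.
by rewrite -big_split; apply: eq_bigr => k _; rewrite mxE scalerDl.
Qed.

Lemma mxact_scalar n (a : A) (z : 'I_n -> N) : mxact a%:M z = a *: z.
Proof.
apply/funext => j; rewrite /mxact (bigD1 j) //= mxE eqxx big1 ?addr0 //.
by move=> k; rewrite mxE eq_sym => /negPf ->; rewrite scale0r.
Qed.

End MatrixAction.

Definition fsingle (N : zmodType) n (j : 'I_n) (x : N) : 'I_n -> N :=
  fun k => if k == j then x else 0.

Lemma fsingle_sum (N : zmodType) n (z : 'I_n -> N) :
  z = \sum_j fsingle j (z j).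
Proof.
apply/funext => k; rewrite fct_sumE (bigD1 k) //= /fsingle eqxx big1 ?addr0 //.
by move=> j; rewrite eq_sym => /negPf ->.
Qed.

Section FamilyGrading.
Variables (G : zmodType) (A : gradedRing G) (N : gradedMod A).
Variables (n : nat) (deg : 'I_n -> G).

(** The grading of [starHom] from the free module with basis degrees [deg j] to [N], a homomorphism
    being identified with its values on the basis. *)
Definition fam_gr (g : G) : set ('I_n -> N) :=
  [set z | forall j, mgr N (g + deg j) (z j)].

Lemma fsingle_gr g j (x : N) : mgr N g x -> fam_gr (g - deg j) (fsingle j x).
Proof.
move=> Hx k; rewrite /fsingle; case: eqP => [->|_]; first by rewrite subrK.
exact: (gr0 (mgrP N)).
Qed.

Lemma fam_grP : is_grading fam_gr.
Proof.
split; first split.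
- by move=> g j; exact: (gr0 (mgrP N)).
- by move=> g x y Hx Hy j; exact: (grB (mgrP N) (Hx j) (Hy j)).
- move=> s f us Hf E g gs; apply/funext => j.
  (* Reindexing by the degree in [N] makes the [j]-th coordinates a family with [h k] of degree
     [k]. *)
  pose h k := f (k - deg j) j.
  rewrite -[LHS]/(f g j); have -> : f g j = h (g + deg j) by rewrite /h addrK.
  apply: (gr_indep_in (mgrP N) (s := [seq k + deg j | k <- s])).
  + by rewrite map_inj_uniq // => k l /addIr.
  + by move=> _ /mapP[k ks ->]; rewrite /h addrK; exact: Hf.
  + rewrite big_map; have := congr1 (fun w : 'I_n -> N => w j) E.
    rewrite fct_sumE /= => E'; rewrite -[RHS]E'.
    by apply: eq_bigr => k _; rewrite /h addrK.
  + exact: (map_f (fun k => k + deg j)).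
- move=> z; rewrite [z]fsingle_sum; elim/big_ind: _ => [||j _].
  + exact: sums0.
  + exact: sumsD.
  apply: (sums_map (f := fsingle j)) (grading_span (mgrP N) (z j)).
  + by apply/funext => k; rewrite /fsingle if_same.
  + move=> x y; apply/funext => k.
    rewrite -[RHS]/(fsingle j x k + fsingle j y k) /fsingle.
    by case: eqP; rewrite ?addr0.
  + by move=> y [g Hy]; exists (g - deg j); exact: fsingle_gr.
Qed.

Lemma fam_grZ m g (a : A) z :
  rgr A m a -> fam_gr g z -> fam_gr (m + g) (a *: z).
Proof. by move=> Ha Hz j; rewrite -addrA; apply: mgrZ. Qed.

Definition fam_mod : gradedMod A := GradedMod fam_grP fam_grZ.

End FamilyGrading.

Section MatrixGradedHom.
Variables (G : zmodType) (A : gradedRing G) (N : gradedMod A).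

Definition hmx m n (dm : 'I_m -> G) (dn : 'I_n -> G) (D : 'M[A]_(m, n)) :=
  forall j k, rgr A (dm j - dn k) (D j k).

(** Free modules are graded as powers of [A] with negated degrees, and the differential between them
    is the transpose; hence the signs. *)
Lemma hmx_tr m n (dm : 'I_m -> G) (dn : 'I_n -> G) (D : 'M[A]_(m, n)) :
  hmx dm dn D -> hmx (fun k => - dn k) (fun j => - dm j) D^T.
Proof. by move=> H k j; rewrite mxE opprK addrC; exact: H. Qed.

Variables (m n : nat) (dm : 'I_m -> G) (dn : 'I_n -> G) (D : 'M[A]_(m, n)).
Hypothesis HD : hmx dm dn D.

Lemma mxact_deg g z : fam_gr (N := N) dn g z -> fam_gr (N := N) dm g (mxact D z).
Proof.
move=> Hz j; apply: (gr_sum (mgrP N)) => k _ _.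
have -> : g + dm j = (dm j - dn k) + (g + dn k) by rewrite addrCA subrK.
exact: mgrZ.
Qed.

Definition mxact_hom : gradedHom (fam_mod N dn) (fam_mod N dm) :=
  @GradedHom _ _ (fam_mod N dn) (fam_mod N dm) (mxact D)
    (mxactP D) mxact_deg.

End MatrixGradedHom.

(** * Comparison of projective resolutions *)

Section GradedHomOps.
Variables (G : zmodType) (A : gradedRing G).

Definition ghom_id (M : gradedMod A) : gradedHom M M :=
  @GradedHom _ _ M M idfun (fun _ _ _ => erefl) (fun _ _ H => H).

Variables (M N : gradedMod A).

Lemma ghom_zero_linear : linear (fun _ : M => 0 : N).
Proof. by move=> c x y; rewrite scaler0 addr0. Qed.

Definition ghom_zero : gradedHom M N :=
  GradedHom ghom_zero_linear (fun n _ _ => gr0 (mgrP N) n).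

Lemma ghom_sub_linear (f g : gradedHom M N) : linear (fun x => f x - g x).
Proof. by move=> c x y; rewrite !ghomD !ghomZ scalerBr opprD addrACA. Qed.

Definition ghom_sub (f g : gradedHom M N) : gradedHom M N :=
  GradedHom (ghom_sub_linear f g)
    (fun n x H => grB (mgrP N) (ghom_deg f H) (ghom_deg g H)).

Lemma ghomB (f : gradedHom M N) x y : f (x - y) = f x - f y.
Proof. exact: linearB. Qed.

End GradedHomOps.

Section Lifting.
Variables (G : zmodType) (A : gradedRing G).

Section Image.
Variables (Z Y : gradedMod A) (e : gradedHom Z Y).

Definition gim_set : set Y := [set y | exists z, e z = y].

Lemma gim0 : gim_set 0. Proof. by exists 0; rewrite ghom0. Qed.
Lemma gimD x y : gim_set x -> gim_set y -> gim_set (x + y).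
Proof. by move=> [u <-] [v <-]; exists (u + v); rewrite ghomD. Qed.
Lemma gimZ (a : A) x : gim_set x -> gim_set (a *: x).
Proof. by move=> [u <-]; exists (a *: u); rewrite ghomZ. Qed.
Lemma gim_gr x : gim_set x -> sums (homog (mgr Y) `&` gim_set) x.
Proof.
move=> [z <-]; apply: (sums_map (ghom0 e) (@ghomD _ _ _ _ e) _
  (grading_span (mgrP Z) z)) => y [n Hy].
by split; [exists n; exact: ghom_deg|exists y].
Qed.

Definition gim : gradedSub (mgr Y) := GradedSub gim0 gimD gimZ gim_gr.
Definition im_mod : gradedMod A := sub_mod gim (mgrP Y) (@mgrZ _ _ Y).

Section Corestriction.
Variables (X : gradedMod A) (f : gradedHom X Y).
Hypothesis fe : forall x, exists z, e z = f x.

Definition corestr_fun (x : X) : im_mod :=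
  exist _ (f x) (introT (gs_predP gim (f x)) (fe x)).

Lemma corestr_linear : linear corestr_fun.
Proof. by move=> c x y; apply: val_inj; rewrite /= ghomD ghomZ. Qed.

Definition corestr : gradedHom X im_mod :=
  @GradedHom _ _ X im_mod corestr_fun corestr_linear
    (fun n x H => ghom_deg f H).

End Corestriction.
End Image.

(** Projectivity speaks of surjections only, so both maps are first corestricted to the graded image
    of [e]. *)
Lemma projective_lift (X Y Z : gradedMod A) (f : gradedHom X Y)
    (e : gradedHom Z Y) : projective X -> (forall x, exists z, e z = f x) ->
  exists h : gradedHom X Z, forall x, e (h x) = f x.
Proof.
move=> pX fe; have ee z : exists z', e z' = e z by exists z.
have [|h Hh] := pX _ _ (corestr ee) (corestr fe).
  move=> [y Hy]; have [z Ez] := elimT (gs_predP (gim e) y) Hy.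
  by exists z; apply: val_inj.
by exists h => x; have := congr1 val (Hh x).
Qed.

End Lifting.

Section Comparison.
Variables (G : zmodType) (A : gradedRing G) (X Y : nat -> gradedMod A).
Variables (dX : forall i, gradedHom (X i.+1) (X i)).
Variables (dY : forall i, gradedHom (Y i.+1) (Y i)).
Hypothesis dX_dX : forall i x, dX i (dX i.+1 x) = 0.
Hypothesis X_proj : forall i, projective (X i.+1).
Hypothesis dY_surj : forall y, exists z, dY 0 z = y.
Hypothesis dY_exact : forall i y, dY i y = 0 <-> exists z, dY i.+1 z = y.

Section Maps.
Variable f0 : gradedHom (X 0) (Y 0).

(** The invariant carried through the recursion along with the map: it provides the next lift, and
    exactness of [Y] then restores it. Index 0 holds the resolved module, hence projectivity from
    index 1 on only. *)
Definition liftable i (f : gradedHom (X i) (Y i)) :=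
  forall x, exists z, dY i z = f (dX i x).

Lemma chain_step i (s : {f | @liftable i f}) :
  {s' : {f | @liftable i.+1 f} | forall x, dY i (sval s' x) = sval s (dX i x)}.
Proof.
apply: cid; case: s => f Hf /=.
have [//|h Hh] := @projective_lift _ _ _ _ _
  (ghom_comp f (dX i)) (dY i) (@X_proj i).
have Hl : liftable h.
  by move=> x; apply/dY_exact; rewrite Hh /= dX_dX ghom0.
by exists (exist _ h Hl).
Qed.

Fixpoint chain_seq i : {f | @liftable i f} :=
  match i with
  | 0 => exist _ f0 (fun x => dY_surj (f0 (dX 0 x)))
  | j.+1 => sval (chain_step (chain_seq j))
  end.

Lemma chain_map_exists : exists f : forall i, gradedHom (X i) (Y i),
  f 0%N = f0 /\ forall i x, dY i (f i.+1 x) = f i (dX i x).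
Proof.
exists (fun i => sval (chain_seq i)); split => // i x.
exact: (svalP (chain_step (chain_seq i)) x).
Qed.

End Maps.

Section Homotopy.
Variable f : forall i, gradedHom (X i) (Y i).
Hypothesis f_chain : forall i x, dY i (f i.+1 x) = f i (dX i x).
Hypothesis f0 : forall x, f 0 x = 0.

(** The map to be lifted in order to continue the homotopy takes values in cycles, which are
    boundaries by exactness. *)
Definition contractible i (s : gradedHom (X i) (Y i.+1)) :=
  forall x, dY i (f i.+1 x - s (dX i x)) = 0.

Lemma homotopy_step i (t : {s | @contractible i s}) :
  {t' : {s | @contractible i.+1 s} |
    forall x, dY i.+1 (sval t' x) = f i.+1 x - sval t (dX i x)}.
Proof.
apply: cid; case: t => s Hs /=.
have [x|h Hh] := @projective_lift _ _ _ _ _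
  (ghom_sub (f i.+1) (ghom_comp s (dX i))) (dY i.+1) (@X_proj i).
  by apply/dY_exact; exact: Hs.
have Hl : contractible h.
  by move=> x; rewrite ghomB f_chain Hh /= dX_dX ghom0 subr0 subrr.
by exists (exist _ h Hl).
Qed.

Lemma contractible0 : @contractible 0 (ghom_zero _ _).
Proof. by move=> x; rewrite /= subr0 f_chain f0. Qed.

Fixpoint homotopy_seq i : {s | @contractible i s} :=
  match i with
  | 0 => exist _ _ contractible0
  | j.+1 => sval (homotopy_step (homotopy_seq j))
  end.

Lemma homotopy_exists : exists s : forall i, gradedHom (X i) (Y i.+1),
  (forall x, s 0%N x = 0) /\
  forall i x, f i.+1 x = dY i.+1 (s i.+1 x) + s i (dX i x).
Proof.
exists (fun i => sval (homotopy_seq i)); split => // i x.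
have /= -> := svalP (homotopy_step (homotopy_seq i)) x.
by rewrite subrK.
Qed.

End Homotopy.
End Comparison.

(** * Non-vanishing of graded Ext, computed from any projective resolution *)

Section ExtNonzero.
Variables (G : zmodType) (A : gradedRing G) (C N : gradedMod A).

(** With [C] put at index 0, the two exactness conditions of a resolution become one. *)
Definition aug_obj (P : projRes C) i : gradedMod A :=
  if i is j.+1 then P j else C.

Definition aug_d (P : projRes C) i : gradedHom (aug_obj P i.+1) (aug_obj P i) :=
  match i with 0 => pr_aug P | j.+1 => pr_d P j end.

Lemma aug_exact (P : projRes C) i x :
  aug_d P i x = 0 <-> exists y, aug_d P i.+1 y = x.
Proof. by case: i x => [|i] x; [exact: pr_exact0|exact: pr_exact]. Qed.

Lemma aug_dd (P : projRes C) i x : aug_d P i (aug_d P i.+1 x) = 0.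
Proof. by apply/aug_exact; exists x. Qed.

(** The cochain [g] may have components of several degrees, as in the submodule divided out in
    [homology]. *)
Definition coboundary (P : projRes C) i : set (P i -> N) :=
  match i with
  | 0 => [set f | forall x, f x = 0]
  | j.+1 => [set f | exists2 g : P j -> N, sums (homog (@homog_hom _ A _ _)) g &
                       forall x, f x = g (pr_d P j x)]
  end.

Definition cocycle (P : projRes C) i (a : G) : set (P i -> N) :=
  [set f | homog_hom a f /\ forall x, f (pr_d P i x) = 0].

Definition nonvanishing (P : projRes C) i (a : G) :=
  exists2 f, @cocycle P i a f & ~ coboundary f.

Lemma star_hom_comp (M M' : gradedMod A) (d : gradedHom M M') (g : M' -> N) :
  sums (homog (@homog_hom _ A _ _)) g ->
  sums (homog (@homog_hom _ A _ _)) (g \o d).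
Proof.
apply: (@sums_map (M' -> N) (M -> N) (fun g => g \o d)) => // f [n Hf].
by exists n; exact: homog_hom_comp.
Qed.

(** Lift the identity of [C] to chain maps [u] from [P] to [Q] and [v] back. A cocycle [f] is pulled
    back along [v]; since [v u] is homotopic to the identity, [f] would be a coboundary if [f v]
    were one. *)
Lemma nonvanishing_transfer (P Q : projRes C) i a :
  nonvanishing P i a -> nonvanishing Q i a.
Proof.
have [u [u0 Hu]] := chain_map_exists (@aug_dd P) (@pr_proj _ _ _ P)
  (@pr_surj _ _ _ Q) (@aug_exact Q) (ghom_id C).
have [v [v0 Hv]] := chain_map_exists (@aug_dd Q) (@pr_proj _ _ _ Q)
  (@pr_surj _ _ _ P) (@aug_exact P) (ghom_id C).
pose w j := ghom_sub (ghom_comp (v j) (u j)) (ghom_id (aug_obj P j)).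
have [||s [s0 Hs]] := homotopy_exists (@aug_dd P) (@pr_proj _ _ _ P)
  (@aug_exact P) (f := w).
- by move=> j x; rewrite /w /= ghomB Hv Hu.
- by move=> x; rewrite /w /= u0 v0 subrr.
move=> [f [Hf fd] nf]; exists (f \o v i.+1).
  split; first exact: homog_hom_comp.
  move=> x; have /= := Hv i.+1 x; rewrite -[aug_d Q i.+1 x]/(pr_d Q i x) => <-.
  exact: fd.
have lf := homog_hom_linear Hf.
have fD x y : f (x + y) = f x + f y by have := lf 1 x y; rewrite !scale1r.
(* Of the two terms of the homotopy, the one in the image of the differential is killed by the
   cocycle [f]. *)
have key x : f x = f (v i.+1 (u i.+1 x)) - f (s i (aug_d P i x)).
  have /= := Hs i x; rewrite /w /= => E.
  have {E} E : v i.+1 (u i.+1 x)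
      = x + (aug_d P i.+1 (s i.+1 x) + s i (aug_d P i x)).
    by rewrite -E addrC subrK.
  by rewrite E !fD fd add0r addrK.
clear Hs w u0 v0.
case: i f Hf fd nf {lf} fD key => [|i] f Hf fd nf fD key /= cob; apply: nf => /=.
  (* In degree 0 the homotopy starts with the zero map on [C], so [f] itself vanishes. *)
  by move=> x; rewrite key cob s0 (_ : f 0 = 0) ?subrr //;
    apply: (addIr (f 0)); rewrite -fD !add0r.
have [g Hg E] := cob.
exists ((g \o u i.+1) - (f \o s i.+1)).
  apply: sumsD; first exact: star_hom_comp.
  apply: sums1; exists a; apply: (grN (homog_homP _ _)).
  exact: homog_hom_comp.
move=> x; rewrite key -[RHS]/(g (u i.+1 (pr_d P i x)) - f (s i.+1 (pr_d P i x))).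
congr (_ - _).
rewrite -(Hu i.+1 x); exact: E.
Qed.

Lemma mgr_nonzero (M : gradedMod A) a :
  mgr M a <> [set 0] <-> exists2 x, mgr M a x & x <> 0.
Proof.
split=> [H|[x Hx nx] E]; last by move: Hx; rewrite E.
apply: contrapT => nH; apply: H; apply/seteqP; split=> [x Hx|_ ->].
  by apply: contrapT => nx; apply: nH; exists x.
exact: (gr0 (mgrP M)).
Qed.

Lemma starExt_nonzero i a :
  mgr (starExt i C N) a <> [set 0] <-> nonvanishing (free_res C) i a.
Proof.
rewrite mgr_nonzero; case: i => [|i].
- split=> [[x Hx nx]|[f [Hf fd] nf]].
  + have Ex : star_pull N (pr_d (free_res C) 0) (val x) = 0.
      exact: (elimT (gs_predP (gker _) _) (valP x)).
    exists (val (val x)) => /=.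
      split; first exact: Hx.
      by move=> y; have := congr1 (fun h => val h y) Ex.
    by move=> E; apply: nx; do 2 apply: val_inj; apply/funext => y; exact: E.
  + have f1 : f \in gs_pred (star_sub (free_res C 0) N).
      by apply/gs_predP; apply: sums1; exists a.
    pose g : starHom (free_res C 0) N := exist _ f f1.
    have g1 : g \in gs_pred (gker (star_pull N (pr_d (free_res C) 0))).
      by apply/gs_predP; apply: val_inj; apply/funext => y; exact: fd.
    exists (exist _ g g1) => //; move=> E; apply: nf => x.
    by have := congr1 (fun h => val (val h) x) E.
- split=> [[x [y Hy Ey] nx]|[f [Hf fd] nf]].
  + have Ex : star_pull N (pr_d (free_res C) i.+1) (val y) = 0.
      exact: (elimT (gs_predP (gker _) _) (valP y)).
    exists (val (val y)).
      split; first exact: Hy.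
      by move=> z; have := congr1 (fun h => val h z) Ex.
    move=> [g Hg E]; apply: nx; rewrite -Ey; apply/quot_pi_eq0.
    have g1 : g \in gs_pred (star_sub (free_res C i) N) by apply/gs_predP.
    exists (exist _ g g1 : starHom _ _); apply: val_inj.
    by apply/funext => z; exact: E.
  + have f1 : f \in gs_pred (star_sub (free_res C i.+1) N).
      by apply/gs_predP; apply: sums1; exists a.
    pose g : starHom (free_res C i.+1) N := exist _ f f1.
    have g1 : g \in gs_pred (gker (star_pull N (pr_d (free_res C) i.+1))).
      by apply/gs_predP; apply: val_inj; apply/funext => y; exact: fd.
    pose h : ker_mod (star_pull N (pr_d (free_res C) i.+1)) := exist _ g g1.
    exists (quot_pi _ h); first by exists h.
    move=> /quot_pi_eq0[k Ek]; apply: nf; exists (val k); first exact: starHomP.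
    by move=> z; have := congr1 (fun h => val h z) Ek.
Qed.

Lemma starExt_res_nonzero (P : projRes C) i a :
  mgr (starExt i C N) a <> [set 0] <-> nonvanishing P i a.
Proof. by rewrite starExt_nonzero; split; exact: nonvanishing_transfer. Qed.

End ExtNonzero.

(** * Matrix resolutions *)

Section Evaluation.
Variables (G : zmodType) (A : gradedRing G) (N : gradedMod A).
Variables (n : nat) (deg : 'I_n -> G).

(** The sign puts the [j]-th basis vector in degree [deg j]. *)
Definition free_fam : gradedMod A := fam_mod (regular_mod A) (fun j => - deg j).

Definition fbase (j : 'I_n) : free_fam := fsingle j (1 : A).

Lemma fbase_gr j : mgr free_fam (deg j) (fbase j).
Proof.
have := @fsingle_gr _ _ (regular_mod A) n (fun j => - deg j) 0 j 1 (rgr1 A).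
by rewrite sub0r opprK.
Qed.

Definition fam_ev (z : 'I_n -> N) (v : free_fam) : N :=
  \sum_j (v j : A) *: z j.

Lemma fam_ev_linear z : linear (fam_ev z).
Proof.
move=> c u v; rewrite /fam_ev scaler_sumr -big_split; apply: eq_bigr => j _ /=.
by rewrite scalerA -scalerDl.
Qed.

Lemma fam_ev_base z j : fam_ev z (fbase j) = z j.
Proof.
rewrite /fam_ev (bigD1 j) //= /fbase /fsingle eqxx scale1r big1 ?addr0 //.
by move=> k /negPf ->; rewrite scale0r.
Qed.

Lemma fbase_sum (v : free_fam) : v = \sum_j (v j : A) *: fbase j.
Proof.
apply/funext => k; rewrite fct_sumE (bigD1 k) //= big1 ?addr0.
  by rewrite -[RHS]/((v k : A) * fsingle k (1 : A) k) /fsingle eqxx mulr1.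
move=> j jk; rewrite -[LHS]/((v j : A) * fsingle j (1 : A) k) /fsingle.
by rewrite eq_sym (negPf jk) mulr0.
Qed.

Lemma fam_ev_uniq (f : free_fam -> N) v : linear f ->
  f v = fam_ev (f \o fbase) v.
Proof.
move=> lf; pose F : {linear free_fam -> N} :=
  HB.pack f (GRing.isLinear.Build A free_fam N _ f lf).
rewrite {1}[v]fbase_sum -[f]/(F : _ -> _) linear_sum.
by apply: eq_bigr => j _; rewrite linearZ.
Qed.

Lemma fam_ev_homog a z : fam_gr (N := N) deg a z -> homog_hom a (fam_ev z).
Proof.
move=> Hz; split=> [|g v Hv]; first exact: fam_ev_linear.
apply: (gr_sum (mgrP N)) => j _ _.
have -> : g + a = (g - deg j) + (a + deg j) by rewrite addrACA addNr addr0.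
apply: mgrZ; [exact: Hv|exact: Hz].
Qed.

Lemma fam_ev_deg z : (forall j, mgr N (deg j) (z j)) ->
  forall g v, mgr free_fam g v -> mgr N g (fam_ev z v).
Proof.
move=> Hz g v Hv; rewrite -[g]addr0.
by have [|_] := @fam_ev_homog 0 z; [move=> j; rewrite add0r|apply].
Qed.

Definition fam_ev_hom z (Hz : forall j, mgr N (deg j) (z j)) :
  gradedHom free_fam N := GradedHom (fam_ev_linear z) (fam_ev_deg Hz).

Lemma homog_hom_base a (f : free_fam -> N) :
  homog_hom a f -> fam_gr (N := N) deg a (f \o fbase).
Proof. by move=> [_ Hf] j; rewrite addrC; apply: Hf; exact: fbase_gr. Qed.

End Evaluation.

Lemma free_fam_projective (G : zmodType) (A : gradedRing G) n (deg : 'I_n -> G) :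
  projective (free_fam A deg).
Proof.
move=> U Y g f sg.
have [w Hw] : {w : 'I_n -> U &
    forall j, mgr U (deg j) (w j) /\ g (w j) = f (fbase A deg j)}.
  apply: (@choice _ _ (fun j u => mgr U (deg j) u /\ g u = f (fbase A deg j))) => j.
  by have [u Hu E] := ghom_lift sg (ghom_deg f (fbase_gr A deg j)); exists u.
exists (fam_ev_hom (fun j => proj1 (Hw j))) => v.
rewrite [RHS](fam_ev_uniq _ (ghom_linear f)) /= /fam_ev ghom_sum.
by apply: eq_bigr => j _; rewrite ghomZ (proj2 (Hw j)).
Qed.

(* The free modules are A^(rk i), with the j-th basis vector in degree
   mdeg i j, and the rows of mD i are the images of the basis vectors of
   A^(rk i.+1); maug lists the images in A of the basis vectors of A^(rk 0). *)
Record mxres (G : zmodType) (A : gradedRing G) (I : set A) := MxRes {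
  rk : nat -> nat;
  mdeg : forall i, 'I_(rk i) -> G;
  mD : forall i, 'M[A]_(rk i.+1, rk i);
  maug : 'I_(rk 0) -> A;
  mD_hmx : forall i, hmx (@mdeg i.+1) (@mdeg i) (mD i);
  maug_deg : forall j, rgr A (mdeg j) (maug j);
  maug_surj : exists v : 'I_(rk 0) -> A, \sum_j v j * maug j = 1;
  mx_exact0 : forall v : 'I_(rk 0) -> A^o,
    I (\sum_j v j * maug j) <-> exists w, mxact (mD 0)^T w = v;
  mx_exact : forall i (v : 'I_(rk i.+1) -> A^o),
    mxact (mD i)^T v = 0 <-> exists w, mxact (mD i.+1)^T w = v }.

Arguments mdeg {G A I} P i j : rename.
Arguments mD {G A I} P i : rename.
Arguments maug {G A I} P j : rename.
Arguments mD_hmx {G A I} P i : rename.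
Arguments maug_deg {G A I} P j : rename.
Arguments maug_surj {G A I} P : rename.
Arguments mx_exact0 {G A I} P v : rename.
Arguments mx_exact {G A I} P i v : rename.

Definition mx_coboundary (G : zmodType) (A : gradedRing G) (I : set A)
    (P : mxres I) (N : lmodType A) i : set ('I_(rk P i) -> N) :=
  match i with
  | 0 => [set z | z = 0]
  | j.+1 => [set z | exists w, z = mxact (mD P j) w]
  end.
Arguments mx_coboundary {G A I} P {N} i.

Section MatrixResolution.
Variables (G : zmodType) (A : gradedRing G) (U : gradedSub (V := A^o) (rgr A)).
Variable P : mxres (gs_set U).

Let C : gradedMod A := quot_mod U (rgrP A) (@rgrM _ A) (grading_span (rgrP A)).

Definition mx_obj i : gradedMod A := free_fam A (mdeg P i).

Definition mx_d i : gradedHom (mx_obj i.+1) (mx_obj i) :=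
  mxact_hom (regular_mod A) (hmx_tr (mD_hmx P i)).

Lemma mx_aug_deg j : mgr C (mdeg P 0 j) (quot_pi U (maug P j)).
Proof. by exists (maug P j) => //; exact: maug_deg. Qed.

Definition mx_aug : gradedHom (mx_obj 0) C := fam_ev_hom mx_aug_deg.

Lemma mx_augE v : mx_aug v = quot_pi U (\sum_j (v j : A) * maug P j).
Proof.
rewrite /= /fam_ev (big_morph (quot_pi U) (@quot_piD _ _ _ _ U) (quot_pi0 U)).
by apply: eq_bigr => j _; exact: quot_scaleE.
Qed.

Lemma mx_aug_surj y : exists x, mx_aug x = y.
Proof.
have [v Ev] := maug_surj P; exists (fun j => quot_repr y * v j).
rewrite mx_augE -[RHS]quot_reprK; congr (quot_pi U _).
under eq_bigr do rewrite -mulrA.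
by rewrite -mulr_sumr Ev mulr1.
Qed.

Lemma mx_res_exact0 x : mx_aug x = 0 <-> exists y, mx_d 0 y = x.
Proof. by rewrite mx_augE quot_pi_eq0; exact: mx_exact0. Qed.

Definition mx_projRes : projRes C :=
  @ProjRes G A C mx_obj mx_d mx_aug (fun i => @free_fam_projective _ _ _ _)
    mx_aug_surj mx_res_exact0 (mx_exact P).

Variable N : gradedMod A.

(** Duality between the differential of the resolution and that of the complex of powers of [N]. *)
Lemma fam_ev_d i (w : 'I_(rk P i) -> N) v :
  fam_ev w (mx_d i v) = fam_ev (mxact (mD P i) w) v.
Proof.
rewrite /fam_ev /= /mxact.
under eq_bigr => k _ do rewrite scaler_suml.
under [RHS]eq_bigr => k _ do rewrite scaler_sumr.
rewrite exchange_big; apply: eq_bigr => j _; apply: eq_bigr => k _.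
by rewrite mxE scalerA [v j * _]mulrC.
Qed.

(** A homomorphism from a finite free module is the same as the family of its values on the basis,
    and under this identification the differential becomes [mxact] by [fam_ev_d]. *)
Lemma starExt_mx_nonzero i a :
  mgr (starExt i C N) a <> [set 0] <->
  exists z : 'I_(rk P i) -> N,
    [/\ fam_gr (mdeg P i) a z, mxact (mD P i) z = 0
      & ~ mx_coboundary P i z].
Proof.
rewrite (starExt_res_nonzero _ mx_projRes); split=> [[f [Hf fd] nf]|[z [Hz zd] nz]].
- have lf := homog_hom_linear Hf.
  exists (f \o @fbase _ _ _ _); split.
  + exact: homog_hom_base.
  + apply/funext => j.
    have := fd (fbase A _ j); rewrite -[pr_d _ _ _]/(mx_d i _) => E.
    by rewrite -[LHS](fam_ev_base (mdeg P i.+1)) -fam_ev_d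
      -fam_ev_uniq.
  + case: i f Hf fd nf lf => [|i] f Hf fd nf lf /= E; apply: nf.
      move=> x; rewrite (fam_ev_uniq _ lf) E /fam_ev big1 // => j _.
      exact: scaler0.
    have [w Ew] := E.
    exists (fam_ev w).
      (* [fam_ev w] must be a sum of homogeneous homomorphisms; these come from the homogeneous
         components of [w]. *)
      have [s Hs ->] := grading_span (fam_grP N (mdeg P i)) w.
      have -> : fam_ev (\sum_(y <- s) y)
          = \sum_(y <- s) fam_ev (deg := mdeg P i) y.
        apply/funext => v; rewrite fct_sumE /fam_ev exchange_big.
        by apply: eq_bigr => j _; rewrite fct_sumE scaler_sumr.
      apply: sums_big => y /Hs[n Hy] _; exists n; exact: fam_ev_homog.
    by move=> x; rewrite (fam_ev_uniq _ lf) Ew -fam_ev_d.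
- exists (fam_ev (deg := mdeg P i) z).
    split; first exact: fam_ev_homog.
    move=> x; rewrite -[pr_d _ _ _]/(mx_d i x) fam_ev_d zd /fam_ev big1 // => j _.
    exact: scaler0.
  case: i z Hz zd nz => [|i] z Hz zd nz /= E; apply: nz.
    by apply/funext => j; rewrite -(fam_ev_base (mdeg P 0) z j) E.
  have [g Hg Eg] := E; exists (g \o fbase A (mdeg P i)).
  apply/funext => j.
  rewrite -[LHS](fam_ev_base (mdeg P i.+1)) Eg.
  rewrite -[RHS](fam_ev_base (mdeg P i.+1)) -fam_ev_d.
  apply: fam_ev_uniq.
  have [s Hs ->] := Hg; move=> c x y; rewrite !fct_sumE scaler_sumr -big_split.
  by apply: eq_big_seq => h /Hs[n [lh _]]; exact: lh.
Qed.

End MatrixResolution.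

Lemma sp_mull (G : zmodType) (A : gradedRing G) (p : starSpec A) (a x : A) :
  gs_set p x -> gs_set p (a * x).
Proof. exact: (@gsZ _ _ _ _ p a x). Qed.

Lemma denomMC (G : zmodType) (A : gradedRing G) (p : starSpec A) (s t : denom p) :
  denomM s t = denomM t s.
Proof. by apply: val_inj; rewrite !denomME mulrC. Qed.

(** * Localization of matrix resolutions *)

Section FractionFamilies.
Variables (G : zmodType) (A : gradedRing G) (p : starSpec A).

Definition hinj (a : A) : hloc_gring p := frac (a : A^o) (denom1 p).

Section Module.
Variable M : gradedMod A.

Definition fam_frac n (x : 'I_n -> M) (s : denom p) : 'I_n -> hloc_gmod p M :=
  fun j => frac (x j) s.

Lemma fam_frac_common n (z : 'I_n -> hloc_gmod p M) :
  exists x s, z = fam_frac x s.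
Proof.
suff [x [s H]] : exists (x : 'I_n -> M) (s : denom p),
    forall j, j \in enum 'I_n -> z j = frac (x j) s.
  by exists x, s; apply/funext => j; apply: H; rewrite mem_enum.
elim: (enum 'I_n) => [|k e [x [s H]]]; first by exists (fun=> 0), (denom1 p).
have [y [t E]] := frac_surj (z k).
exists (fun j => if j == k then val s *: y else val t *: x j), (denomM s t).
move=> j; rewrite inE /=; case: eqP => [-> _|_ /= je].
  by rewrite E denomMC frac_scale.
by rewrite (H j je) frac_scale.
Qed.

Lemma fam_frac_scale n (x : 'I_n -> M) s (t : denom p) :
  fam_frac (val t *: x) (denomM s t) = fam_frac x s.
Proof. by apply/funext => j; exact: frac_scale. Qed.

Lemma fam_fracB n (x y : 'I_n -> M) s :
  fam_frac x s - fam_frac y s = fam_frac (x - y) s.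
Proof. by apply/funext => j; exact: fracB1. Qed.

Lemma fam_frac_eq0 n (x : 'I_n -> M) s :
  fam_frac x s = 0 <-> exists2 u, hmult p u & u *: x = 0.
Proof.
split=> [E|[u hu E]]; last first.
  apply/funext => j; apply/frac_eq0; exists u => //.
  exact: (congr1 (fun w : 'I_n -> M => w j) E).
suff [u hu H] : exists2 u, hmult p u & forall j, j \in enum 'I_n -> u *: x j = 0.
  by exists u => //; apply/funext => j; apply: H; rewrite mem_enum.
elim: (enum 'I_n) => [|k e [u hu H]]; first by exists 1 => //; exact: hmult1.
have /frac_eq0[v hv F] : frac (x k) s = 0.
  exact: (congr1 (fun w : 'I_n -> hloc_gmod p M => w k) E).
exists (u * v) => [|j]; first exact: hmultM.
rewrite inE => /orP[/eqP ->|je]; first by rewrite -scalerA F scaler0.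
by rewrite mulrC -scalerA H // scaler0.
Qed.

Lemma hinj_scale (a : A) (x : M) s :
  hinj a *: (frac x s : hloc_gmod p M) = frac (a *: x) s.
Proof.
rewrite [LHS]hscaleE; apply/fracE; exists 1; first exact: hmult1.
by rewrite !denomME mul1r.
Qed.

Lemma mxact_frac m n (D : 'M[A]_(m, n)) (x : 'I_n -> M) s :
  mxact (map_mx hinj D) (fam_frac x s) = fam_frac (mxact D x) s.
Proof.
apply/funext => j; rewrite /mxact /fam_frac -frac_sum.
by apply: eq_bigr => k _; rewrite mxE hinj_scale.
Qed.

End Module.

(** Every element of the extended ideal has a numerator in [p]. Clearing denominators in an equality
    of fractions multiplies by elements outside [p], which can be cancelled because [p] is prime. *)
Lemma hloc_max_frac (x : A) s :
  hloc_max_set (frac (x : A^o) s : hloc_gring p) <-> gs_set p x.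
Proof.
split=> [H|px].
  suff [y [t [py E]]] : exists y t, gs_set p y /\
      (frac (x : A^o) s : hloc_gring p) = frac (y : A^o) t.
    move: E => /fracE[u [_ nu] E].
    have : gs_set p (u * (val s * y)) by do 2 apply: sp_mull.
    rewrite -[u * _]E => /sp_prime[//|/sp_prime[nt|//]].
    by case: (denomP t).
  have [l Hl ->] := H; elim: l Hl => [|z l IH] Hl.
    by exists 0, (denom1 p); rewrite big_nil frac_0; split => //; exact: gs0.
  have [w wl|y [t [py E]]] := IH; first by apply: Hl; rewrite inE wl orbT.
  have [a [_ [[v pv ->] ->]]] := Hl z (mem_head _ _).
  rewrite big_cons E.
  have [b [r ->]] := frac_surj a.
  rewrite [_ *: _]hscaleE fracD; eexists; eexists; split; last reflexivity.
  by apply: gsD; [apply: gsZ; exact: gsZ|exact: gsZ].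
apply: sums1; exists (frac (1 : A^o) s), (hinj x); split; first by exists x.
rewrite [RHS]hscaleE; apply/fracE; exists 1; first exact: hmult1.
by rewrite denomME denom1E mulr1 !scale1r.
Qed.

Section Localization.
Variable P : mxres (gs_set p).

Definition hloc_mD i : 'M[hloc_gring p]_(rk P i.+1, rk P i) :=
  map_mx hinj (mD P i).

Lemma hinj_gr n (a : A) : rgr A n a -> rgr (hloc_gring p) n (hinj a).
Proof.
move=> Ha; exists a, (denom1 p), 0.
by split => //; [rewrite addr0|exact: rgr1].
Qed.

Lemma hloc_mD_hmx i : hmx (mdeg P i.+1) (mdeg P i) (hloc_mD i).
Proof. by move=> j k; rewrite mxE; apply: hinj_gr; exact: mD_hmx. Qed.

Lemma hloc_aug_sum (x : 'I_(rk P 0) -> A^o) s :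
  \sum_j (fam_frac (M := regular_mod A) x s j : hloc_gring p) * hinj (maug P j)
  = frac (\sum_j x j * maug P j : A^o) s.
Proof.
rewrite -frac_sum; apply: eq_bigr => j _; rewrite mulrC mulrC.
rewrite [LHS]hscaleE; apply/fracE; exists 1; first exact: hmult1.
by rewrite !denomME mulr1.
Qed.

Lemma mxact_hloc i (x : 'I_(rk P i.+1) -> A^o) s :
  mxact (hloc_mD i)^T (fam_frac (M := regular_mod A) x s
    : 'I_(rk P i.+1) -> (hloc_gring p)^o)
  = fam_frac (M := regular_mod A) (mxact (mD P i)^T x) s.
Proof. by rewrite /hloc_mD map_trmx; exact: (@mxact_frac (regular_mod A)). Qed.

Lemma hloc_aug_surj :
  exists v : 'I_(rk P 0) -> hloc_gring p, \sum_j v j * hinj (maug P j) = 1.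
Proof.
have [v Ev] := maug_surj P; exists (fam_frac (M := regular_mod A) v (denom1 p)).
by rewrite hloc_aug_sum Ev.
Qed.

Lemma hloc_exact0 (v : 'I_(rk P 0) -> (hloc_gring p)^o) :
  hloc_max_set (\sum_j v j * hinj (maug P j)) <->
  exists w, mxact (hloc_mD 0)^T w = v.
Proof.
have [x [s ->]] := @fam_frac_common (regular_mod A) _ v.
rewrite hloc_aug_sum hloc_max_frac (mx_exact0 P x); split=> [[w <-]|[w]].
  exists (fam_frac (M := regular_mod A) w s); exact: mxact_hloc.
have [y [t ->]] := @fam_frac_common (regular_mod A) _ w.
rewrite mxact_hloc -(fam_frac_scale x s t) -(fam_frac_scale _ t s) => E.
have {}E : fam_frac (M := regular_mod A)
    (val s *: mxact (mD P 0)^T y - val t *: x) (denomM s t) = 0.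
  by rewrite -fam_fracB -E denomMC subrr.
move/fam_frac_eq0: E => [u hu E].
(* Over [A] only the multiple of [x] by [u] and the denominator [t] is known to be a boundary; both
   factors lie outside [p] and are cancelled in [p]. *)
suff : gs_set p (\sum_j (u *: (val t *: x)) j * maug P j).
  have -> : \sum_j (u *: (val t *: x)) j * maug P j
      = u * (val t * (\sum_j x j * maug P j)).
    rewrite !mulr_sumr; apply: eq_bigr => j _.
    by rewrite -[LHS]/(u * (val t * (x j : A)) * maug P j) !mulrA.
  case: hu => _ nu; have [_ nt] := denomP t.
  by move=> /sp_prime[//|/sp_prime[//|/(mx_exact0 P x)]].
apply/(mx_exact0 P); exists (u *: (val s *: y)); rewrite !mxactZ.
by move: E; rewrite scalerBr => /subr0_eq E; exact: E.
Qed.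

Lemma hloc_exact i (v : 'I_(rk P i.+1) -> (hloc_gring p)^o) :
  mxact (hloc_mD i)^T v = 0 <-> exists w, mxact (hloc_mD i.+1)^T w = v.
Proof.
split=> [|[w <-]].
  have [x [s ->]] := @fam_frac_common (regular_mod A) _ v.
  rewrite mxact_hloc => /(@fam_frac_eq0 (regular_mod A))[u hu].
  rewrite -(mxactZ (N := regular_mod A)) => /mx_exact[w E].
  (* [w] lifts [u *: x] rather than [x], so [u] is added to the denominator. *)
  exists (fam_frac (M := regular_mod A) w (denomM s (mk_denom hu))).
  rewrite mxact_hloc E.
  exact: (@fam_frac_scale (regular_mod A) _ x s (mk_denom hu)).
have [x [s ->]] := @fam_frac_common (regular_mod A) _ w.
rewrite !mxact_hloc (_ : mxact _ (mxact _ x) = 0); last first.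
  by apply/mx_exact; exists x.
by apply/funext => j; exact: frac_0.
Qed.

Definition hloc_mxres : mxres (gs_set (hloc_max p)) :=
  @MxRes G (hloc_gring p) (hloc_max_set (p := p)) (rk P) (mdeg P) hloc_mD
    (hinj \o maug P) hloc_mD_hmx (fun j => hinj_gr (maug_deg P j))
    hloc_aug_surj hloc_exact0 hloc_exact.

Variable M : gradedMod A.

Lemma hloc_coboundary i (x : 'I_(rk P i) -> M) s :
  mx_coboundary hloc_mxres i (fam_frac x s) <->
  exists2 u, hmult p u & mx_coboundary P i (u *: x).
Proof.
case: i x => [|i] x /=; first exact: fam_frac_eq0.
split=> [[w]|[u hu [w E]]].
  have [y [t ->]] := fam_frac_common w.
  rewrite mxact_frac -(fam_frac_scale x s t) -(fam_frac_scale _ t s) => E.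
  have {}E : fam_frac (val t *: x - val s *: mxact (mD P i) y) (denomM s t) = 0.
    by rewrite -fam_fracB E denomMC subrr.
  move/fam_frac_eq0: E => [u hu E].
  exists (u * val t); first exact: hmultM (denomP t).
  exists (u *: (val s *: y)); rewrite !mxactZ.
  by move: E; rewrite scalerBr => /subr0_eq E; rewrite -scalerA; exact: E.
exists (fam_frac w (denomM s (mk_denom hu))).
by rewrite mxact_frac -E; exact: esym (fam_frac_scale x s (mk_denom hu)).
Qed.

(* A class of the cohomology of the unlocalized complex survives in the
   localization iff no homogeneous element outside p kills it. *)
Definition survives i (a : G) :=
  exists (k : G) (t : A) (x : 'I_(rk P i) -> M),
  [/\ rgr A k t, hmult p t, fam_gr (mdeg P i) (a + k) x, mxact (mD P i) x = 0
    & forall u, hmult p u -> ~ mx_coboundary P i (u *: x)].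

(** By [hloc_mxres] the localized matrices compute this module; a cocycle of degree [a] is then
    written as a fraction [x/t], with [x] of degree [a] plus the degree of [t]. *)
Lemma starExt_hloc_nonzero i a :
  mgr (starExt i (residue_mod p) (hloc_gmod p M)) a <> [set 0] <->
  survives i a.
Proof.
rewrite (starExt_mx_nonzero hloc_mxres); split=> [[z]|].
  move=> [Hz zd nz].
  have [t [k [x [tk Hx]]]] : exists (t : denom p) (k : G) (x : 'I_(rk P i) -> M),
      rgr A k (val t) /\ forall j, j \in enum 'I_(rk P i) ->
        mgr M (a + k + mdeg P i j) (x j) /\ z j = frac (x j) t.
    elim: (enum _) => [|l e [t [k [x [tk Hx]]]]].
      by exists (denom1 p), 0, (fun=> 0); split; [exact: rgr1|].
    have [y [u [m [Hy um E]]]] := Hz l.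
    exists (denomM t u), (k + m),
      (fun j => if j == l then val t *: y else val u *: x j).
    split; first exact: rgrM.
    move=> j; rewrite inE; case: eqP => [-> _|_ /= je].
      split; last by rewrite E denomMC frac_scale.
      have -> : a + (k + m) + mdeg P i l = k + (a + mdeg P i l + m).
        by rewrite (AC (1*2*1) (2*(1*4*3)))%AC.
      exact: mgrZ.
    have [Hxj ->] := Hx j je.
    rewrite -(frac_scale (x j) t u); split => //.
    have -> : a + (k + m) + mdeg P i j = m + (a + k + mdeg P i j).
      by rewrite (AC (1*2*1) (3*(1*2*4)))%AC.
    exact: mgrZ.
  have Ez : z = fam_frac x t.
    by apply/funext => j; have [|_ ->] := Hx j; rewrite ?mem_enum.
  have := zd; rewrite Ez mxact_frac => /fam_frac_eq0[u hu Eu].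
  have [[l ul] _] := hu.
  (* [x] is a cocycle only after multiplication by [u]; enlarging the denominator by the same factor
     keeps the degree [a]. *)
  exists (k + l), (val t * u), (u *: x); split.
  + exact: rgrM.
  + exact: hmultM (denomP t) hu.
  + move=> j; have -> : a + (k + l) + mdeg P i j = l + (a + k + mdeg P i j).
      by rewrite [k + l]addrC addrCA -addrA addrA.
    by apply: mgrZ => //; have [] := Hx j; rewrite ?mem_enum.
  + by rewrite mxactZ.
  + move=> v hv H; apply: nz; rewrite Ez; apply/hloc_coboundary.
    by exists (v * u); [exact: hmultM|rewrite -scalerA].
move=> [k [t [x [tk ht Hx xd nx]]]].
exists (fam_frac x (mk_denom ht)); split.
- move=> j; exists (x j), (mk_denom ht), k; split => //.
  by rewrite addrAC; exact: Hx.
- by rewrite mxact_frac xd; apply/funext => j; exact: frac_0.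
- by move=> /hloc_coboundary[u hu]; exact: nx.
Qed.

End Localization.
End FractionFamilies.

(** * Matrix resolutions over noetherian rings *)

Section Span.
Variables (R : comPzRingType) (V : lmodType R).
Implicit Types (X : set V) (s : seq V).

Lemma lspanZ X (a : R) x : lspan X x -> lspan X (a *: x).
Proof.
apply: sums_map; [exact: scaler0|exact: scalerDr|].
by move=> _ [b [v [Xv ->]]]; exists (a * b), v; rewrite scalerA.
Qed.

Lemma lspan_mem X x : X x -> lspan X x.
Proof. by move=> Xx; apply: sums1; exists 1, x; rewrite scale1r. Qed.

Lemma lspan_sub X (Y : set V) x :
  (forall y, X y -> lspan Y y) -> lspan X x -> lspan Y x.
Proof. by move=> H; apply: sumsW => _ [a [v [/H Yv ->]]]; exact: lspanZ. Qed.

Lemma lspan_cons y s x : lspan [set` y :: s] x ->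
  exists (a : R) v, lspan [set` s] v /\ x = a *: y + v.
Proof.
move=> [t Ht ->]; elim: t Ht => [|z t IH] Ht.
  by exists 0, 0; rewrite big_nil scale0r addr0; split => //; exact: sums0.
have [w wt|a [v [sv E]]] := IH; first by apply: Ht; rewrite inE wt orbT.
have [b [w [/= ws Ez]]] := Ht z (mem_head _ _).
rewrite big_cons E Ez; move: ws; rewrite inE => /orP[/eqP ->|ws].
  by exists (b + a), v; rewrite scalerDl addrA.
exists a, (b *: w + v); rewrite addrCA; split => //; apply: sumsD => //.
exact/lspanZ/lspan_mem.
Qed.

Lemma lspan_nil x : lspan [set` [::]] x -> x = (0 : V).
Proof. by move=> [s Hs ->]; rewrite big_seq big1 // => y /Hs[a [v []]]. Qed.

Lemma lspan_nth s x : lspan [set` s] x ->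
  exists c : 'I_(size s) -> R, x = \sum_l c l *: s`_l.
Proof.
elim: s x => [|y s IH] x.
  by move=> /lspan_nil ->; exists (fun=> 0); rewrite big_ord0.
move=> /lspan_cons[a [v [/IH[c ->] ->]]].
exists (fun l => if unlift ord0 l is Some k then c k else a).
rewrite big_ord_recl unlift_none; congr (_ + _).
by apply: eq_bigr => l _; rewrite liftK.
Qed.

Definition submodule (U : set V) := [/\ U 0, forall x y, U x -> U y -> U (x + y)
  & forall (a : R) x, U x -> U (a *: x)].

Hypothesis R_noeth : noetherian R.

(** Induction on the number of generators of the ambient span: the elements of [U] without a term in
    [m] form a smaller case, and the coefficients of [m] in [U] form an ideal. *)
Lemma noetherian_submodule s (U : set V) : submodule U -> U `<=` lspan [set` s] ->
  exists2 t : seq V, (forall y, y \in t -> U y) & U `<=` lspan [set` t].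
Proof.
elim: s U => [|m s IH] U HU Us.
  by exists [::] => // x /Us /lspan_nil ->; exact: sums0.
have [U0 UD UZ] := HU.
pose W := U `&` lspan [set` s].
have [|x []|t tW Wt] := IH W; [|by []|].
  split; first by split => //; exact: sums0.
    by move=> x y [? ?] [? ?]; split; [exact: UD|exact: sumsD].
  by move=> a x [? ?]; split; [exact: UZ|exact: lspanZ].
pose I : set R := [set a | exists2 v, lspan [set` s] v & U (a *: m + v)].
have [||a b [v Hv Uv]|g Ig] := R_noeth (I := I).
- by exists 0; [exact: sums0|rewrite scale0r addr0].
- move=> a b [v Hv Uv] [w Hw Uw]; exists (v + w); first exact: sumsD.
  by rewrite scalerDl addrACA; exact: UD.
- exists (a *: v); first exact: lspanZ.
  by rewrite -scalerA -scalerDr; exact: UZ.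
have gen_mem a : a \in g -> lspan (V := R^o) [set` g] a.
  by move=> ag; apply: sums1; exists 1, a; rewrite scale1r.
have gI a : a \in g -> exists v, lspan [set` s] v /\ U (a *: m + v).
  move=> ag; have [v sv Uv] : I a by rewrite Ig; exact: gen_mem.
  by exists v.
(* Each generator [a] of the coefficient ideal is lifted to an element [a *: m + f a] of [U]. *)
have [f Hf] : {f : R -> V &
    forall a, a \in g -> lspan [set` s] (f a) /\ U (a *: m + f a)}.
  apply: (@choice _ _ (fun a v =>
    a \in g -> lspan [set` s] v /\ U (a *: m + v))) => a.
  have [/gI[v Hv]|] := boolP (a \in g); first by exists v.
  by exists 0.
exists ([seq a *: m + f a | a <- g] ++ t).
  move=> y; rewrite mem_cat => /orP[/mapP[a /Hf[_ ?] ->]|/tW[]] //.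
set T := _ ++ t.
have tT : {subset t <= T} by move=> y yt; rewrite mem_cat yt orbT.
have gT a : a \in g -> lspan [set` T] (a *: m + f a).
  by move=> ag; apply: lspan_mem; rewrite /= mem_cat (map_f (fun a => a *: m + f a)).
have red a : lspan (V := R^o) [set` g] a ->
    exists2 v, lspan [set` s] v & lspan [set` T] (a *: m + v) /\ U (a *: m + v).
  move=> [l Hl ->]; elim: l Hl => [|b l IHl] Hl.
    exists 0; first exact: sums0.
    by rewrite big_nil scale0r addr0; split => //; exact: sums0.
  have [c cl|v Hv [Tv Uv]] := IHl; first by apply: Hl; rewrite inE cl orbT.
  have [c [d [/= dg Eb]]] := Hl b (mem_head _ _).
  have [sfd Ufd] := Hf d dg.
  exists (c *: f d + v); first by apply: sumsD => //; exact: lspanZ.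
  have -> : (\sum_(j <- b :: l) j) *: m + (c *: f d + v)
      = c *: (d *: m + f d) + ((\sum_(j <- l) j) *: m + v).
    by rewrite big_cons Eb scalerDl addrACA scalerDr scalerA.
  split; first by apply: sumsD => //; exact/lspanZ/gT.
  by apply: UD => //; exact: UZ.
move=> x Ux; have [a [v [sv Ex]]] := lspan_cons (Us x Ux).
have : I a by exists v => //; rewrite -Ex.
rewrite Ig => /red[w sw [Tw Uw]].
(* Subtracting a combination of the lifts with the same coefficient of [m] leaves an element of
   [W]. *)
have -> : x = (a *: m + w) + (v - w) by rewrite Ex -addrA [w + _]addrC subrK.
apply: sumsD => //; apply: lspan_sub (Wt (v - w) _).
  by move=> y /tT; exact: lspan_mem.
split; last by apply: sumsD => //; rewrite -scaleN1r; exact: lspanZ.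
have -> : v - w = x + -1 *: (a *: m + w) by rewrite Ex scaleN1r [_ + v]addrC addrKA.
by apply: UD => //; exact: UZ.
Qed.

End Span.

Section GradedGeneration.
Variables (G : zmodType) (A : gradedRing G).

Lemma fin_gen_fam (N : gradedMod A) n (deg : 'I_n -> G) :
  fin_gen N -> fin_gen (fam_mod N deg).
Proof.
move=> [s Hs]; exists [seq fsingle j y | j <- enum 'I_n, y <- s].
apply/seteqP; split=> // z _; rewrite (fsingle_sum z).
elim/big_ind: _ => [||j _]; [exact: sums0|exact: sumsD|].
have : lspan [set` s] (z j) by rewrite Hs.
apply: (@sums_map N (fam_mod N deg) (fsingle j)).
- by apply/funext => k; rewrite /fsingle if_same.
- move=> x y; apply/funext => k.
  rewrite -[RHS]/(fsingle j x k + fsingle j y k) /fsingle.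
  by case: eqP; rewrite ?addr0.
- move=> _ [a [v [sv ->]]]; exists a, (fsingle j v); split.
    by apply/allpairsP; exists (j, v); rewrite mem_enum.
  apply/funext => k; rewrite -[RHS]/(a *: fsingle j v k) /fsingle.
  by case: eqP; rewrite ?scaler0.
Qed.

Lemma fin_gen_regular : fin_gen (regular_mod A).
Proof.
exists [:: 1 : A]; apply/seteqP; split=> // a _; apply: sums1.
by exists a, 1; split; [rewrite /= inE|rewrite -[RHS]/(a * 1) mulr1].
Qed.

Hypothesis A_noeth : noetherian A.

Lemma graded_generators (M : gradedMod A) (U : gradedSub (mgr M)) : fin_gen M ->
  exists n (deg : 'I_n -> G) (z : 'I_n -> M),
    (forall j, mgr M (deg j) (z j) /\ gs_set U (z j)) /\
    forall x, gs_set U x -> exists c : 'I_n -> A, x = \sum_j c j *: z j.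
Proof.
move=> [s Hs].
have [|x _|t tU Ut] := @noetherian_submodule _ M A_noeth s (gs_set U).
- by split; [exact: gs0|exact: gsD|move=> a x; exact: gsZ].
- by rewrite Hs.
(* Each generator is replaced by homogeneous summands of it that lie in [U]. *)
have [t' t'U tt'] : exists2 t' : seq M,
    (forall y, y \in t' -> homog (mgr M) y /\ gs_set U y) & forall y, y \in t -> lspan [set` t'] y.
  elim: t tU {Ut} => [|y t IH] tU; first by exists [::].
  have [z zt|t' t'U tt'] := IH; first by apply: tU; rewrite inE zt orbT.
  have [l Hl E] := gs_gr (tU y (mem_head _ _)).
  exists (l ++ t') => z; first by rewrite mem_cat => /orP[/Hl|/t'U].
  rewrite inE => /orP[/eqP ->|/tt' Hz].
    rewrite E big_seq; elim/big_ind: _ => [||w wl]; [exact: sums0|exact: sumsD|].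
    by apply: lspan_mem; rewrite /= mem_cat wl.
  by apply: lspan_sub Hz => w wt'; apply: lspan_mem; rewrite /= mem_cat wt' orbT.
have ht (j : 'I_(size t')) : exists d, mgr M d t'`_j.
  by have [] := t'U t'`_j (mem_nth _ (ltn_ord j)).
have [d Hd] := choice ht.
exists (size t'), d, (fun j => t'`_j); split.
  by move=> j; split => //; have [] := t'U t'`_j (mem_nth _ (ltn_ord j)).
move=> x Ux; apply: lspan_nth; apply: lspan_sub (Ut x Ux) => y; exact: tt'.
Qed.

(* The submodule of A^n to be covered by the next free module. *)
Record mx_syzygy := MxSyzygy {
  ms_rk : nat;
  ms_deg : 'I_ms_rk -> G;
  ms_sub : gradedSub (mgr (free_fam A ms_deg)) }.

Record mx_cover (S : mx_syzygy) := MxCover {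
  mc_rk : nat;
  mc_deg : 'I_mc_rk -> G;
  mc_D : 'M[A]_(mc_rk, ms_rk S);
  mc_hmx : hmx mc_deg (@ms_deg S) mc_D;
  mc_sub : forall v : 'I_(ms_rk S) -> A^o,
    gs_set (ms_sub S) v <-> exists w, mxact mc_D^T w = v }.

(** The rows of the matrix are homogeneous generators of the submodule. *)
Lemma mx_cover_exists S : exists C : mx_cover S, True.
Proof.
case: S => n deg U.
have [m [dm [z [Hz gz]]]] := graded_generators U
  (fin_gen_fam (fun j => - deg j) fin_gen_regular).
pose D : 'M[A]_(m, n) := \matrix_(j, k) (z j k : A).
have HD : hmx dm deg D.
  by move=> j k; rewrite mxE; have [H _] := Hz j; exact: H.
have E (w : 'I_m -> A^o) : mxact D^T w = \sum_j (w j : A) *: z j.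
  apply/funext => k; rewrite fct_sumE /mxact; apply: eq_bigr => j _.
  by rewrite !mxE -[LHS]/((z j k : A) * w j) mulrC.
unshelve eexists (@MxCover (@MxSyzygy n deg U) m dm D HD _) => //= v.
split=> [/gz[c ->]|[w <-]]; first by exists c; exact: E.
by rewrite E; apply: gs_sum => j _; apply: gsZ; have [] := Hz j.
Qed.

Definition mx_cover_of S : mx_cover S := projT1 (cid (mx_cover_exists S)).

Definition mx_next S : mx_syzygy :=
  let C := mx_cover_of S in
  @MxSyzygy (mc_rk C) (@mc_deg _ C)
    (gker (mxact_hom (regular_mod A) (hmx_tr (@mc_hmx _ C)))).

Variable I : gradedSub (V := A^o) (rgr A).

Definition syz0_set : set ('I_1 -> A^o) := [set v | gs_set I (v ord0)].

Lemma syz0_gr v : syz0_set v ->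
  sums (homog (mgr (free_fam A (fun _ : 'I_1 => 0))) `&` syz0_set) v.
Proof.
move=> Iv; have Ef (x : 'I_1 -> A^o) : x = fun _ => x ord0.
  by apply/funext => j; rewrite (ord1 j).
rewrite (Ef v).
apply: (@sums_map A ('I_1 -> A^o) (fun a _ => a) (homog (rgr A) `&` gs_set I)) => //.
  move=> a [[n Hn] Ia]; split => //; exists n => j.
  by have : rgr A (n - 0) a by rewrite subr0.
exact: (gs_gr Iv).
Qed.

(** The resolution starts with A^1 in degree 0 and the augmentation 1, so the first submodule to
    cover is [I] itself. *)
Definition mx_syz0 : mx_syzygy :=
  @MxSyzygy 1 (fun=> 0) (@GradedSub _ _ _ (mgr (free_fam A (fun _ : 'I_1 => 0)))
    syz0_set (gs0 I) (fun x y => @gsD _ _ _ _ I (x ord0) (y ord0))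
    (fun a x => @gsZ _ _ _ _ I a (x ord0)) syz0_gr).

Definition mx_syz i : mx_syzygy := iter i mx_next mx_syz0.

Lemma noetherian_mxres : exists P : mxres (gs_set I), True.
Proof.
pose C i := mx_cover_of (mx_syz i).
unshelve eexists (@MxRes G A (gs_set I) (fun i => ms_rk (mx_syz i))
  (fun i => @ms_deg (mx_syz i)) (fun i => mc_D (C i)) (fun=> 1)
  (fun i => @mc_hmx _ (C i)) (fun _ => rgr1 A) _ _ _) => //.
- by exists (fun=> 1); rewrite big_ord1 mulr1.
- by move=> v; rewrite -(mc_sub (C 0)) big_ord1 mulr1.
- by move=> i v; rewrite -(mc_sub (C i.+1)).
Qed.

End GradedGeneration.

(** * Null-homotopies and the graded submodule of coboundaries *)

Section Annihilation.
Variables (G : zmodType) (A : gradedRing G) (I : set A) (P : mxres I).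

Lemma mx_row_lift m n q (X : 'M[A]_(m, n)) (D : 'M[A]_(q, n)) :
  (forall j, exists w : 'I_q -> A^o, mxact D^T w = X j) ->
  exists h, X = h *m D.
Proof.
move=> /choice[w Hw]; exists (\matrix_(j, k) (w j k : A)).
apply/matrixP => j k; rewrite -(Hw j) mxE; apply: eq_bigr => l _.
by rewrite !mxE -[LHS]/(D l k * w j l) mulrC.
Qed.

(** Row by row, this is exactness applied to the images of the basis vectors. *)
Lemma mD_mD i : mD P i.+1 *m mD P i = 0.
Proof.
apply/matrixP => j k; rewrite !mxE.
pose v : 'I_(rk P i.+2) -> A^o := fsingle j (1 : A).
have Ev : mxact (mD P i.+1)^T v = mD P i.+1 j.
  apply/funext => l; rewrite /mxact (bigD1 j) //= !mxE big1 ?addr0.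
    by rewrite /v /fsingle eqxx -[LHS]/(mD P i.+1 j l * 1) mulr1.
  by move=> r /negPf nr; rewrite /v /fsingle nr scaler0.
have /(congr1 (fun w => w k)) := proj2 (mx_exact P i _) (ex_intro _ v Ev).
rewrite /mxact => E; rewrite -[RHS]E; apply: eq_bigr => l _.
by rewrite mxE mulrC.
Qed.

(* Multiplication by a in I is null-homotopic on the resolution of A/I. *)
Lemma mx_homotopy (a : A) (N : lmodType A) i : (forall b, I (b * a)) ->
  (exists h, mD P i *m (h *m mD P i) = mD P i *m a%:M) /\
  (forall x : 'I_(rk P i) -> N, mxact (mD P i) x = 0 ->
     mx_coboundary P i (a *: x)).
Proof.
move=> Ia; elim: i => [|i [[h Eh] _]].
(* The augmentation sends [a] times a basis vector into [I], so the rows of [a%:M] lift through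
   [mD P 0]. *)
- have [j|h Eh] := @mx_row_lift _ _ _ (a%:M : 'M_(rk P 0)) (mD P 0).
    apply/mx_exact0; rewrite (bigD1 j) //= mxE eqxx big1 ?addr0 1?mulrC //.
    by move=> k; rewrite mxE eq_sym => /negPf ->; rewrite mul0r.
  split; first by exists h; rewrite Eh.
  by move=> x xd /=; rewrite -mxact_scalar Eh mxact_mul xd linear0.
(* By induction [a%:M - mD P i *m h] is annihilated by [mD P i] on the right, so it factors through
   [mD P i.+1]; on a cocycle [x] this gives [a *: x] as the coboundary of [mxact h x]. *)
- have [j|k Ek] := @mx_row_lift _ _ _ (a%:M - mD P i *m h) (mD P i.+1).
    apply/mx_exact; apply/funext => l.
    have /matrixP/(_ j l) : (a%:M - mD P i *m h) *m mD P i = 0.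
      by rewrite mulmxBl -mulmxA Eh scalar_mxC subrr.
    rewrite [X in X = _]mxE [X in _ = X]mxE => E; rewrite -[RHS]E.
    by rewrite /mxact; apply: eq_bigr => r _; rewrite [_^T _ _]mxE [RHS]mulrC.
  split.
    by exists k; rewrite -Ek mulmxBr mulmxA mD_mD mul0mx subr0.
  move=> x xd /=; exists (mxact h x).
  rewrite -mxact_mul -mxact_scalar -[a%:M](subrK (mD P i *m h)) Ek.
  by rewrite mxactDl mxact_mul xd linear0 add0r.
Qed.

End Annihilation.

(** The component of degree [a] of the difference is [x] alone, and [U] contains the components of
    its elements. *)
Lemma gs_component_other (G : zmodType) (A : gradedRing G) (M : gradedMod A)
    (U : gradedSub (mgr M)) (J : finType) (v : J -> M) (b : J -> G) a x :
  mgr M a x -> (forall l, mgr M (b l) (v l)) -> (forall l, b l <> a) ->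
  gs_set U (x - \sum_l v l) -> gs_set U x.
Proof.
move=> Hx Hv nb; pose s := undup (a :: [seq b l | l <- enum J]).
pose f h := (if h == a then x else 0) - \sum_(l | b l == h) v l.
have bs l : b l \in s.
  by rewrite mem_undup inE (map_f b) ?orbT // mem_enum.
have -> : x - \sum_l v l = \sum_(h <- s) f h.
  have pick (y : M) h : h \in s -> \sum_(k <- s) (if k == h then y else 0) = y.
    move=> hs; rewrite -big_mkcond -big_filter filter_pred1_uniq ?undup_uniq //.
    by rewrite big_seq1.
  rewrite sumrB pick ?mem_undup ?mem_head //; congr (_ - _).
  under [RHS]eq_bigr do rewrite big_mkcond.
  rewrite exchange_big; apply: eq_bigr => l _ /=.
  by under eq_bigr do rewrite eq_sym; rewrite pick.
move=> /gs_component H.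
have /H : a \in s by rewrite mem_undup mem_head.
rewrite /f eqxx big1 ?subr0; last by move=> l /eqP /nb.
apply; first exact: undup_uniq.
move=> h; apply: (grB (mgrP M)).
  by case: eqP => [->|_] //; exact: (gr0 (mgrP M)).
by apply: (gr_sum (mgrP M)) => l _ /eqP <-.
Qed.

Section CoboundaryTheory.
Variables (G : zmodType) (A : gradedRing G) (I : set A) (P : mxres I).

Lemma mx_coboundaryD (N : lmodType A) i (x y : 'I_(rk P i) -> N) :
  mx_coboundary P i x -> mx_coboundary P i y -> mx_coboundary P i (x + y).
Proof.
case: i x y => [|i] x y /=; first by move=> -> ->; rewrite addr0.
by move=> [u ->] [v ->]; exists (u + v); rewrite linearD.
Qed.

Lemma mx_coboundaryZ (N : lmodType A) i (a : A) (x : 'I_(rk P i) -> N) :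
  mx_coboundary P i x -> mx_coboundary P i (a *: x).
Proof.
case: i x => [|i] x /=; first by move=> ->; rewrite scaler0.
by move=> [u ->]; exists (a *: u); rewrite mxactZ.
Qed.

Lemma mx_coboundary0 (N : lmodType A) i :
  mx_coboundary P i (0 : 'I_(rk P i) -> N).
Proof. by case: i => [|i] //=; exists 0; rewrite linear0. Qed.

Lemma mx_coboundary_gr (M : gradedMod A) i (x : 'I_(rk P i) -> M) :
  mx_coboundary P i x ->
  sums (homog (mgr (fam_mod M (mdeg P i))) `&` mx_coboundary P i) x.
Proof.
case: i x => [|i] x /=; first by move=> ->; exact: sums0.
move=> [w Ew]; have H : gim_set (mxact_hom M (mD_hmx P i)) x by exists w.
by apply: sumsW (gim_gr H) => y [hy [z Ez]]; apply: sums1; split; [|exists z].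
Qed.

Definition mx_cob (M : gradedMod A) i : gradedSub (mgr (fam_mod M (mdeg P i))) :=
  @GradedSub _ _ _ (mgr (fam_mod M (mdeg P i))) (mx_coboundary P i)
    (@mx_coboundary0 M i) (@mx_coboundaryD M i) (@mx_coboundaryZ M i)
    (@mx_coboundary_gr M i).

End CoboundaryTheory.

(** * Coarsening *)

Section CoarsenedResolution.
Variables (G H : zmodType) (phi : {additive G -> H}).
Variables (A : gradedRing G) (p : starSpec A) (P : mxres (gs_set p)).

Local Notation A' := (coarsen_ring phi A).
Local Notation p' := (coarsen_prime phi p).

Lemma coarse_mem (V : zmodType) (gr : G -> set V) n x :
  gr n x -> coarse phi gr (phi n) x.
Proof. by move=> Hx; apply: sums1; exists n. Qed.

Lemma coarsen_hmx i :
  @hmx _ A' _ _ (phi \o mdeg P i.+1) (phi \o mdeg P i) (mD P i).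
Proof. by move=> j k; rewrite /= -raddfB; apply: coarse_mem; exact: mD_hmx. Qed.

(** Exactness does not mention degrees, so only homogeneity has to be proved again. *)
Definition coarsen_mxres : mxres (gs_set p') :=
  @MxRes H A' (gs_set p) (rk P) (fun i => phi \o mdeg P i) (mD P) (maug P)
    coarsen_hmx (fun j => coarse_mem (maug_deg P j)) (maug_surj P)
    (mx_exact0 P) (mx_exact P).

Variable M : gradedMod A.
Local Notation M' := (coarsen_mod phi M).

Lemma coarse_fam n (deg : 'I_n -> G) h (x : 'I_n -> M) :
  fam_gr (N := M') (phi \o deg) h x <-> coarse phi (fam_gr (N := M) deg) h x.
Proof.
split=> [Hx|[s Hs ->] j].
  rewrite (fsingle_sum x); elim/big_ind: _ => [||j _]; [exact: sums0|exact: sumsD|].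
  apply: (sums_map (f := fsingle j)) (Hx j).
  - by apply/funext => k; rewrite /fsingle if_same.
  - move=> y z; apply/funext => k.
    rewrite -[RHS]/(fsingle j y k + fsingle j z k) /fsingle.
    by case: eqP; rewrite ?addr0.
  - move=> y [m mh Hy]; exists (m - deg j); last exact: fsingle_gr.
    by rewrite raddfB mh addrK.
rewrite fct_sumE; apply: (gr_sum (mgrP M')) => y /Hs[m mh Hy] _.
by rewrite -mh /= -raddfD; apply: coarse_mem; exact: Hy.
Qed.

(** If all homogeneous components of [u] were in [p], so would be their sum. *)
Lemma coarse_hmult (u : A) h : rgr A' h u -> ~ gs_set p u ->
  exists (s : seq G) (f : G -> A), [/\ uniq s, forall n, rgr A n (f n),
    u = \sum_(n <- s) f n & exists2 n, phi n = h & hmult p (f n) /\ n \in s].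
Proof.
move=> Hu nu.
have [s [f [us Ps Hf E]]] := sums_decomp (P := [set n | phi n = h]) (rgrP A) Hu.
exists s, f; split => //.
apply: contrapT => nH; apply: nu; rewrite E.
apply: (@gs_sum _ _ (regular_mod A) p) => n ns.
apply: contrapT => npf; apply: nH; exists n; first exact: Ps.
by split => //; split => //; exists n.
Qed.

Lemma survives_coarsen i a : survives P M i a -> survives coarsen_mxres M' i (phi a).
Proof.
move=> [k [t [x [tk ht Hx xd nx]]]].
exists (phi k), t, x; split => //.
- exact: coarse_mem.
- by split; [exists (phi k); exact: coarse_mem|have [] := ht].
- by apply/coarse_fam; rewrite -raddfD; exact: coarse_mem.
move=> u [[h Hu] nu] cob.
have [s [f [us Hf E [n nh [hfn ns]]]]] := coarse_hmult Hu nu.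
apply: (nx _ hfn).
(* Since [x] is homogeneous of degree [a + k], these are the components of [u *: x], indexed by
   their degrees; all are coboundaries with [u *: x]. *)
pose F m := f (m - (a + k)) *: x.
have -> : f n *: x = F (n + (a + k)) by rewrite /F addrK.
apply: (@gs_component _ _ _ (mx_cob P M i) [seq l + (a + k) | l <- s] F).
- by rewrite map_inj_uniq // => m l /addIr.
- move=> m; have -> : m = (m - (a + k)) + (a + k) by rewrite subrK.
  by rewrite /F addrK; apply: mgrZ => //; exact: Hf.
- suff -> : \sum_(m <- [seq l + (a + k) | l <- s]) F m = u *: x by exact: cob.
  rewrite big_map E scaler_suml; apply: eq_bigr => m _.
  by rewrite /F addrK.
- exact: (map_f (fun l => l + (a + k))).
Qed.

(** The components of a cocycle are cocycles. If each were killed by a homogeneous element outside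
    [p], the product of these elements would kill the whole class. *)
Lemma survives_refine i h : survives coarsen_mxres M' i h ->
  exists2 a, phi a = h & survives P M i a.
Proof.
move=> [k [t [x [tk [_ nt] Hx xd nx]]]].
have [_ [g [_ Hg _ [l lk [hgl _]]]]] := coarse_hmult tk nt.
move/coarse_fam: Hx => Hx.
have [s [f [us Ps Hf E]]] :=
  sums_decomp (P := [set n | phi n = h + k]) (fam_grP M (mdeg P i)) Hx.
suff [n ns nf] : exists2 n, n \in s &
    forall u, hmult p u -> ~ mx_coboundary P i (u *: f n).
  (* The new denominator is a component of [t] outside [p], of degree [l] above [k]; the fraction
     [f n / g l] has degree [n - l]. *)
  exists (n - l); first by rewrite raddfB lk (Ps n ns) addrK.
  exists l, (g l), (f n); split => //; first by rewrite subrK.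
  apply: (@gs_component _ _ _ (gker (mxact_hom M (mD_hmx P i))) s f) => //.
  by rewrite -E; exact: xd.
apply: contrapT => nH.
suff [u [[m um] nu] cob] : exists2 u, hmult p u &
    mx_coboundary P i (u *: \sum_(n <- s) f n).
  apply: (nx u); last by rewrite E.
  by split => //; exists (phi m); exact: coarse_mem.
have {}nH n : n \in s -> exists2 u, hmult p u & mx_coboundary P i (u *: f n).
  move=> ns; apply: contrapT => nu; apply: nH; exists n => // u hu cob.
  by apply: nu; exists u.
clear -nH; elim: s nH => [|n s IH] nH.
  exists 1; first exact: hmult1.
  by rewrite big_nil scaler0; exact: mx_coboundary0.
have [m ms|u hu cu] := IH; first by apply: nH; rewrite inE ms orbT.
have [v hv cv] := nH n (mem_head _ _).
exists (u * v); first exact: hmultM.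
rewrite big_cons scalerDr; apply: mx_coboundaryD.
  by rewrite -scalerA; exact: mx_coboundaryZ.
by rewrite mulrC -scalerA; exact: mx_coboundaryZ.
Qed.

End CoarsenedResolution.

Lemma mgr_coarsen_nonzero (G H : zmodType) (phi : {additive G -> H})
    (A : gradedRing G) (M : gradedMod A) h :
  mgr (coarsen_mod phi M) h <> [set 0] <->
  exists2 n, phi n = h & mgr M n <> [set 0].
Proof.
rewrite mgr_nonzero; split=> [[x [s Hs E] nx]|[n <- /mgr_nonzero[x Hx nx]]].
  apply: contrapT => nH; apply: nx; rewrite E big_seq big1 // => y /Hs[n nh Hy].
  apply: contrapT => ny; apply: nH; exists n => //; apply/mgr_nonzero.
  by exists y.
by exists x => //; exact: coarse_mem.
Qed.

Lemma enum_val_setT m (D : {set 'I_m}) (k : 'I_#|D|) :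
  D = [set: 'I_m]%SET -> enum_val k = k :> nat.
Proof.
move=> E; have ED : enum D = enum 'I_m by rewrite E enum_setT enumT.
have km : (k < m)%N by have := ltn_ord k; rewrite {2}E cardsT card_ord.
by rewrite /enum_val ED nth_enum_ord.
Qed.

(** * Standard multigraded rings *)

Section StandardRing.
Variables (r : nat) (R : gradedRing 'rV[int]_r) (p : starSpec R).
Hypothesis R_std : standard R.

Local Notation phi := (dir_proj p).

Lemma dir_proj_eq0 (n : 'rV[int]_r) :
  phi n = 0 <-> forall j, j \in dir p -> n 0 j = 0.
Proof.
split=> [E j jp|E]; last by apply/rowP => j; rewrite !mxE E // enum_valP.
by have /rowP/(_ (enum_rank_in jp j)) := E; rewrite !mxE enum_rankK_in.
Qed.

(** Such sums form a subring. It contains each generator of degree e_j: this lies in [p] if [j] is a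
    direction of [p], and has [phi]-degree 0 otherwise. *)
Lemma standard_split (x : R) :
  exists y z, [/\ gs_set p y, coarse phi (rgr R) 0 z & x = y + z].
Proof.
pose B : {pred R} := fun x => `[< exists y z,
  [/\ gs_set p y, coarse phi (rgr R) 0 z & x = y + z] >].
have grR := coarseP phi (rgrP R).
suff : x \in B by move/asboolP.
apply: R_std.
- split.
  + apply/asboolP; exists 0, 1; split; [exact: gs0| |by rewrite add0r].
    exact: coarse_ring1.
  + move=> a b /asboolP[y [z [py z0 ->]]] /asboolP[y' [z' [py' z0' ->]]].
    apply/asboolP; exists (y - y'), (z - z'); split.
    * by apply: gsD => //; rewrite -mulN1r; exact: sp_mull.
    * exact: (grB grR).
    * by rewrite opprD addrACA.
  + move=> a b /asboolP[y [z [py z0 ->]]] /asboolP[y' [z' [py' z0' ->]]].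
    apply/asboolP; exists (y' * (y + z) + z' * y), (z * z'); split.
    * apply: gsD; last exact: sp_mull.
      by rewrite mulrC; exact: sp_mull.
    * by have := coarse_ringM z0 z0'; rewrite addr0.
    * by rewrite [LHS]mulrDr [(y + z) * z']mulrDl [_ * y']mulrC [y * z']mulrC addrA.
- move=> y Hy; apply/asboolP; exists 0, y; split; [exact: gs0| |by rewrite add0r].
  by have := coarse_mem phi Hy; rewrite raddf0.
- move=> j y Hy; apply/asboolP; have [jp|jp] := boolP (j \in dir p).
    exists y, 0; split; [|exact: sums0|by rewrite addr0].
    by move: jp; rewrite inE => /asboolP; apply.
  exists 0, y; split; [exact: gs0| |by rewrite add0r].
  have := coarse_mem phi Hy; suff -> : phi (delta_mx 0 j) = 0 by [].
  apply/dir_proj_eq0 => k kp; rewrite mxE eqxx /=.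
  by case: eqP jp => // <-; rewrite kp.
Qed.

(** Modulo [p], the element [x] agrees with one of [phi]-degree 0, whereas its own [phi]-degree is
    not 0. *)
Lemma dir_nonzero_mem n (x : R) : rgr R n x -> phi n <> 0 -> gs_set p x.
Proof.
move=> Hx nz; have [y [z [py z0 E]]] := standard_split x.
apply: (@gs_component_other _ _ (regular_mod (coarsen_ring phi R))
  (coarsen_prime phi p) 'I_1 (fun=> z) (fun=> 0) (phi n)) => //.
- exact: coarse_mem.
- by move=> _ /esym.
- by rewrite big_ord1 E addrK.
Qed.

Lemma dir_hmult n (x : R) : rgr R n x -> ~ gs_set p x -> phi n = 0.
Proof. by move=> Hx npx; apply: contrapT => /(dir_nonzero_mem Hx). Qed.

Lemma dir_coarsen : dir (coarsen_prime phi p) = [set: 'I_#|dir p|]%SET.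
Proof.
apply/setP => j; rewrite !inE; apply/asboolP => x [s Hs ->].
apply: (@gs_sum _ _ (regular_mod R) p) => y /Hs[n nj Hy].
apply: (dir_nonzero_mem Hy) => /dir_proj_eq0/(_ (enum_val j) (enum_valP j)).
have /rowP/(_ j) := nj; rewrite !mxE !eqxx /= => -> /eqP.
by rewrite oner_eq0.
Qed.

(** By [dir_coarsen] the coarsened prime has all directions, so its projection is the identity up to
    the cast of the index type. *)
Lemma castmx_dir_proj (e : #|dir (coarsen_prime phi p)| = #|dir p|)
    (h : 'rV[int]_#|dir p|) :
  castmx (erefl 1%N, e) (dir_proj (coarsen_prime phi p) h) = h.
Proof.
apply/rowP => j; rewrite castmxE !mxE cast_ord_id.
by congr (h _ _); apply: val_inj; rewrite /= (enum_val_setT _ dir_coarsen).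
Qed.

Variables (P : mxres (gs_set p)) (M : gradedMod R).

Lemma survives_finite i : noetherian R -> fin_gen M ->
  finite_set [set phi n | n in survives P M i].
Proof.
move=> R_noeth M_fg.
have [m [d [z [Hz gz]]]] := graded_generators R_noeth
  (gker (mxact_hom M (mD_hmx P i))) (fin_gen_fam (mdeg P i) M_fg).
apply: (@sub_finite_set _ _ [set phi (d l) | l in [set: 'I_m]]); last first.
  exact/finite_image/finite_finset.
move=> _ [n [k [t [x [tk [ht npt] Hx xd nx]]]] <-] /=.
apply: contrapT => nl.
have [c Ec] := gz x xd.
have [y Hy] := choice (fun l => standard_split (c l)).
have [w Hw] := choice Hy.
(* If [phi n] is not the [phi]-degree of a generator, the cocycle [x] is already a coboundary, so it
   is killed by 1. *)
apply: (nx 1); first exact: hmult1.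
rewrite scale1r.
apply: (@gs_component_other _ _ _
  (mx_cob (coarsen_mxres phi P) (coarsen_mod phi M) i) 'I_m
  (fun l => w l *: z l) (fun l => phi (d l)) (phi n)).
(* [x] has degree [n + k], where [k] is the degree of a denominator outside [p], so that [phi k] is
   0. *)
- apply/coarse_fam; rewrite -[phi n]addr0 -(dir_hmult tk npt) -raddfD.
  exact: coarse_mem.
- move=> l; rewrite -[phi (d l)]add0r; apply: mgrZ; first by have [] := Hw l.
  by apply/coarse_fam; apply: coarse_mem; have [] := Hz l.
- by move=> l E; apply: nl; exists l.
- have -> : x - \sum_l w l *: z l = \sum_l y l *: z l.
    (* Only the parts [y l] of the coefficients in [p] remain; by [mx_homotopy] they turn the
       cocycles [z l] into coboundaries. *)
    rewrite Ec -sumrB; apply: eq_bigr => l _.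
    by have [_ _ ->] := Hw l; rewrite scalerDl addrK.
  apply: (@gs_sum _ _ _ (mx_cob P M i)) => l _.
  have Ia b : gs_set p (b * y l) by apply: sp_mull; have [] := Hw l.
  have [_] := mx_homotopy P M i Ia; apply.
  by have [_] := Hz l.
Qed.

End StandardRing.

(** * Anchor points as degrees of surviving classes *)

Section AnchorPoints.
Variables (r : nat) (R : gradedRing 'rV[int]_r) (p : starSpec R).
Variables (P : mxres (gs_set p)) (M : gradedMod R).

Lemma anch_survives i :
  anch i p M = [set dir_proj p n | n in survives P M i].
Proof.
apply/seteqP; split=> a.
  by move=> /mgr_coarsen_nonzero[n <- /(starExt_hloc_nonzero P)]; exists n.
move=> [n Hn <-]; apply/mgr_coarsen_nonzero; exists n => //.
exact/(starExt_hloc_nonzero P).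
Qed.

End AnchorPoints.

Theorem theorem2p11 (r : nat) (r_gt0 : (0 < r)%N)
    (R : gradedRing 'rV[int]_r) (R_noeth : noetherian R)
    (R_pos : positively_graded R) (R_std : standard R)
    (M : gradedMod R) (i : nat) (p : starSpec R)
    (p_var : starVar (lspan (V := R^o) (rgr R (const_mx 1))) p) :
  (exists e : #|dir (coarsen_prime (dir_proj p) p)| = #|dir p|,
     anch i p M =
     [set castmx (erefl 1%N, e) a | a in
        anch i (coarsen_prime (dir_proj p) p) (coarsen_mod (dir_proj p) M)])
  /\ (fin_gen M -> finite_set (anch i p M)).
Proof.
have [P _] := noetherian_mxres R_noeth p.
rewrite (anch_survives P); split; last exact: survives_finite.
have e : #|dir (coarsen_prime (dir_proj p) p)| = #|dir p|.
  by rewrite dir_coarsen // cardsT card_ord.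
(* Both sets of anchor points are read off from the same matrices, with the original and with the
   coarsened degrees. *)
exists e; rewrite (anch_survives (coarsen_mxres (dir_proj p) P)).
apply/seteqP; split=> [_ [n Hn <-]|_ [_ [h Hh <-] <-]].
  exists (dir_proj (coarsen_prime (dir_proj p) p) (dir_proj p n)).
    by exists (dir_proj p n) => //; exact: survives_coarsen.
  exact: castmx_dir_proj.
rewrite castmx_dir_proj //.
by have [n <- Hn] := survives_refine Hh; exists n.
Qed.
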